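(* Let $\alpha\in[0,1)$ be fixed, let $\nu$ be a probability distribution on $\mathbb{R}$, and let $\pi$ be a positive and continuously differentiable Lebesgue probability density on $\mathbb{R}_+=(0,\infty)$. Consider the Gaussian sequence model with partial information and the marginal posterior $\Pi(\cdot\mid Y,Z)$ of $\sigma^2$ described in the context, with i.i.d. $\nu$-distributed prior on the unknown means and independent prior density $\pi$ on $\sigma^2$. Then, for all sufficiently large $\sigma_0^2$, there exists a mean vector $\mu_0$ (that is, for every $n$ a vector $\mu_0=(\mu^0_{n_1+1},\ldots,\mu_n^0)\in\mathbb{R}^{n_2}$) such that $$\lim_{n\to\infty} E_0^n\Big[\Pi\Big( \Big| \frac{\sigma^2}{\sigma_0^2}-1\Big| \leq \frac 12 \,\Big|\,Y,Z\Big)\Big] = 0.$$ Consequently, the posterior is inconsistent and asymptotically assigns all its mass outside of a neighbourhood of the true variance.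
   Context: Model: for fixed $\alpha$ and sample size $n$, put $n_1=\lfloor n\alpha\rfloor$ and $n_2=n-n_1$. One observes independent $X_i\sim\mathcal{N}(\mu_i^0\mathbf{1}(i>n\alpha),\sigma_0^2)$, $i=1,\ldots,n$, with $\sigma_0^2>0$ and $\mu_0=(\mu^0_{n_1+1},\ldots,\mu^0_n)\in\mathbb{R}^{n_2}$ unknown. Write $Y=(X_1,\ldots,X_{n_1})$ (the observations with zero mean) and $Z=(X_{n_1+1},\ldots,X_n)$. $P_0^n$ and $E_0^n$ denote probability and expectation under this model with true parameters $(\sigma_0^2,\mu_0)$. Prior: $\sigma^2$ and $\mu$ are independent; $\sigma^2$ has density $\pi$; the $n_2$ components of $\mu$ are i.i.d. with distribution $\nu$ on $\mathbb{R}$. Neither $\pi$ nor $\nu$ depends on $n$. Marginal posterior: $\Pi(\cdot\mid Y,Z)$ is the distribution on $(0,\infty)$ with density $$\pi(\sigma^2\mid Y,Z)=\frac{L(\sigma^2\mid Y,Z)\,\pi(\sigma^2)}{\int_0^\infty L(s\mid Y,Z)\,\pi(s)\,ds},\qquad L(\sigma^2\mid Y,Z)=\sigma^{-n}e^{-\frac{\|Y\|^2}{2\sigma^2}}\int_{\mathbb{R}^{n_2}}e^{-\frac{\|Z-\mu\|^2}{2\sigma^2}}\,d\nu^{\otimes n_2}(\mu),$$ where $\|\cdot\|$ is the Euclidean norm. ''For all sufficiently large $\sigma_0^2$'' means: there is a threshold, not depending on $n$ (it may depend on $\alpha$, $\nu$, $\pi$), such that the assertion holds for every $\sigma_0^2$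 above it. *)

(* Defs.v *)
From HB Require Import structures.
From mathcomp Require Import all_boot all_order all_algebra.
From mathcomp Require Import all_classical all_reals all_analysis.
Set Implicit Arguments.
Unset Strict Implicit.
Unset Printing Implicit Defensive.
Import Order.TTheory GRing.Theory Num.Theory.
Import numFieldNormedType.Exports.
Local Open Scope classical_set_scope.
Local Open Scope ring_scope.

Section product_probability.
Context d (T : measurableType d) (R : realType).

Definition consp n (x : T * n.-tuple T) : n.+1.-tuple T :=
  [tuple of x.1 :: x.2].

Lemma measurable_consp n : measurable_fun [set: T * n.-tuple T] (@consp n).
Proof. exact: (measurable_cons measurable_fst measurable_snd). Qed.

HB.instance Definition _ n :=
  isMeasurableFun.Build _ _ _ _ (@consp n) (@measurable_consp n).

(* Product of the (possibly different) probabilities P 0, ..., P (n - 1),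
   i.e. the law of an n-tuple of independent T-valued variables whose i-th
   coordinate has law P i; see product_prob_rect. *)
Fixpoint product_prob n : ('I_n -> probability T R) ->
    probability (n.-tuple T) R :=
  match n with
  | 0 => fun _ => \d_([tuple] : 0.-tuple T)
  | n'.+1 => fun P =>
      distribution (P ord0 \x product_prob (fun i => P (lift ord0 i)))%E
        (@consp n')
  end.

Lemma product_prob_rect n (P : 'I_n -> probability T R) (A : 'I_n -> set T) :
  (forall i, measurable (A i)) ->
  product_prob P [set t | forall i, A i (tnth t i)] =
  (\prod_(i < n) P i (A i))%E.
Proof.
elim: n P A => [|n IH] P A mA.
  rewrite big_ord0/= (_ : [set t | _] = setT) ?probability_setT//.
  by apply/seteqP; split=> t //= _ [].
have mB : measurable [set t : n.-tuple T | forall i, A (lift ord0 i) (tnth t i)].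
  rewrite (_ : [set t | _] =
      \bigcap_(i in [set: 'I_n]) ((@tnth n T) ^~ i @^-1` A (lift ord0 i))).
    apply: fin_bigcap_measurable => // i _.
    by rewrite -[X in measurable X]setTI; exact: measurable_tnth.
  by apply/seteqP; split=> t /= H i; [move=> _; exact: H | exact: H].
rewrite big_ord_recl -IH//= /pushforward.
rewrite -product_measure1E//; congr (product_measure1 _ _ _).
apply/seteqP; split=> -[x t] /=.
  move=> H; split=> [|i]; first exact: (H ord0).
  by have := H (lift ord0 i); rewrite tnthS.
move=> [Hx Ht] i; have [j ->|->] := unliftP ord0 i; last by [].
by rewrite tnthS; exact: Ht.
Qed.

End product_probability.

Section model.
Context (R : realType).
Local Notation RR := (measurableTypeR R).

Definition nzero (alpha : R) (n : nat) : nat := Num.truncn (n%:R * alpha).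

(* With 0-based indices, the coordinate i : 'I_n is X_(i+1); the boolean
   test reads i + 1 > n alpha, equivalently nzero alpha n <= i. *)
Definition mean0 (alpha : R) n (mu0 : (n - nzero alpha n).-tuple R)
    (i : 'I_n) : R :=
  if n%:R * alpha < i.+1%:R then nth 0 mu0 (i - nzero alpha n) else 0.

(* normal_prob is parametrized by the standard deviation. *)
Definition P0 (alpha v0 : R) n (mu0 : (n - nzero alpha n).-tuple R) :
    probability (n.-tuple RR) R :=
  product_prob (fun i => normal_prob (mean0 mu0 i) (Num.sqrt v0)).

Definition obsY (alpha : R) n (X : n.-tuple R) : seq R :=
  take (nzero alpha n) X.

Definition obsZ (alpha : R) n (X : n.-tuple R) :
    (n - nzero alpha n).-tuple R :=
  [tuple of drop (nzero alpha n) X].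

Definition sqdist m (x y : m.-tuple R) : R :=
  \sum_(j < m) (tnth x j - tnth y j) ^+ 2.

(* The argument s stands for the variance sigma^2 in this definition and
   the following ones. *)
Definition likelihood (alpha : R) (nu : probability RR R) n (X : n.-tuple R)
    (s : R) : R :=
  Num.sqrt s ^- n
  * expR (- (\sum_(y <- obsY alpha X) y ^+ 2) / (2 * s))
  * \int[product_prob (fun _ : 'I_(n - nzero alpha n) => nu)]_mu
      expR (- sqdist (obsZ alpha X) mu / (2 * s)).

Definition evidence (alpha : R) (nu : probability RR R) (prior : R -> R) n
    (X : n.-tuple R) : R :=
  \int[lebesgue_measure]_(s in `]0, +oo[) (likelihood alpha nu X s * prior s).

(* For a prior density, the marginal likelihood is positive, and it is finite
   except on a Lebesgue-null, hence P0-null, set of data X; on that set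
   evidence is 0 by convention. *)
Definition posterior_density (alpha : R) (nu : probability RR R)
    (prior : R -> R) n (X : n.-tuple R) (s : R) : R :=
  likelihood alpha nu X s * prior s / evidence alpha nu prior X.

Definition posterior (alpha : R) (nu : probability RR R) (prior : R -> R) n
    (X : n.-tuple R) (A : set R) : R :=
  \int[lebesgue_measure]_(s in `]0, +oo[ `&` A)
    posterior_density alpha nu prior X s.

(* The posterior mass of the complement of every neighbourhood of v0 tends to 0
   in probability under the true parameters. *)
Definition posterior_consistent (alpha : R) (nu : probability RR R)
    (prior : R -> R) (v0 : R)
    (mu0 : forall n, (n - nzero alpha n).-tuple R) : Prop :=
  forall e delta : R, 0 < e -> 0 < delta ->
    P0 v0 (mu0 n) [set X |
      delta < posterior alpha nu prior X [set s : R | e < `|s - v0|]]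
    @[n --> \oo] --> 0%E.

Definition C1_positive_density (prior : R -> R) : Prop :=
  [/\ forall s : R, 0 < s -> 0 < prior s,
      forall s : R, 0 < s -> derivable prior s 1,
      forall s : R, 0 < s -> {for s, continuous prior^`()%classic} &
      (\int[lebesgue_measure]_(s in `]0%R, +oo[) (prior s)%:E = 1)%E].

End model.

(* Main.v *)
Require Import Defs.
From mathcomp Require Import all_boot all_order all_algebra.
From mathcomp Require Import all_classical all_reals all_analysis.
From mathcomp Require Import measurable_realfun ring lra.

(* Take all the unknown means equal to [m = C * sqrt v0], with
   [C = 1000 / (1 - alpha)].  For [v0] large, the prior [nu] puts almost no
   mass at the scale of [m], so the marginal likelihood can explain [Z] only as
   noise around the bulk of [nu], i.e. through a variance of order [C^2 v0].
   On the event where the sum of the [(X_i - mean_i)^2] is at most [8 n v0],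
   whose complement has probability at most [e^-n], the likelihood at any
   [s] in [[v0 / 2, 3 v0 / 2]] is at most [e^-n] times the likelihood at any
   [t] in [[C^2 v0, 2 C^2 v0]], so that the posterior mass of the former
   interval is exponentially small.  The remaining mass is its complement to 1
   because the evidence is almost surely finite: by Tonelli's theorem its
   expectation is at most [v0^(- n / 2)]. *)

Set Implicit Arguments.
Unset Strict Implicit.
Unset Printing Implicit Defensive.
Import Order.TTheory GRing.Theory Num.Theory.
Import numFieldNormedType.Exports.
Local Open Scope classical_set_scope.
Local Open Scope ring_scope.

(** The constant [C] settles a race between two rates. Moving from [s >= v0 / 2] to [t <= 2 C^2 v0]
    divides the normalising factor of each coordinate, known zeros included, by at most [2 C].
    Explaining a mean [C sqrt v0] with a variance of order [v0] costs [exp (- C^2 / 24)] per unknown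
    coordinate, and there are at least [(1 - alpha) n] of these. Since [(1 - alpha) C = 1000], the
    larger variance gains [exp (1000 C n / 24)] and loses at most [exp (2 C n)] in normalisation and
    [exp (13 n)] in noise terms. Large [v0] enters only through [K^2 <= v0], where [[-K, K]] carries
    [nu] up to mass [exp (- C^2 / 24)]; hence a threshold free of [n]. The prior density enters
    through the mass [b > 0] of [[C^2 v0, 2 C^2 v0]], which is also free of [n] and so cannot offset
    [e^-n]. Infinite evidence makes the posterior of every set 0 by convention. This is harmless for
    upper bounds, but it would break the passage to complements, which is why almost sure finiteness
    is proved. *)

(** * Integration against product laws and against laws with a density *)

Section measure_facts.
Local Open Scope ereal_scope.

(** Independence, by induction: the first coordinate is split off and Tonelli's theorem separates it
    from the rest. It serves both the prior on the unknown means and the law of the data. *)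
Lemma ge0_integral_product_prob d (T : measurableType d) (R : realType) n
    (P : 'I_n -> probability T R) (f : 'I_n -> T -> R) :
  (forall i, measurable_fun setT (f i)) -> (forall i x, (0 <= f i x)%R) ->
  \int[product_prob P]_t (\prod_(i < n) f i (tnth t i))%:E =
  \prod_(i < n) \int[P i]_x (f i x)%:E.
Proof.
elim: n P f => [|n IH] P f mf f0.
  rewrite [RHS]big_ord0 /=; under eq_integral do rewrite big_ord0.
  by rewrite integral_cst//= mul1e diracT.
have mprod : measurable_fun [set: n.-tuple T] (EFin \o (fun t : n.-tuple T =>
    \prod_(i < n) f (lift ord0 i) (tnth t i))%R).
  apply/measurable_EFinP; apply: measurable_prod => i _.
  by apply: measurableT_comp => //; exact: measurable_tnth.
have mf' i : measurable_fun setT (EFin \o f i).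
  exact/measurable_EFinP.
rewrite big_ord_recl -IH//=.
rewrite ge0_integral_distribution; first last.
- by move=> t; rewrite lee_fin; apply: prodr_ge0 => i _.
- apply/measurable_EFinP; apply: measurable_prod => i _.
  by apply: measurableT_comp => //; exact: measurable_tnth.
transitivity (\int[P ord0 \x product_prob (fun i => P (lift ord0 i))]_z
    ((f ord0 z.1)%:E * (\prod_(i < n) f (lift ord0 i) (tnth z.2 i))%:E)).
  apply: eq_integral => z _ /=; rewrite big_ord_recl -EFinM.
  by congr ((_ * _)%:E); apply: eq_bigr => i _; rewrite tnthS.
rewrite fubini_tonelli1//=; first last.
- by move=> z; rewrite -EFinM lee_fin mulr_ge0//; exact: prodr_ge0.
- apply: emeasurable_funM.
    exact: (measurableT_comp (mf' ord0) measurable_fst).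
  exact: (measurableT_comp mprod measurable_snd).
rewrite /fubini_F/=.
under eq_integral => x _.
  rewrite ge0_integralZl//;
    [|by move=> t _; rewrite lee_fin prodr_ge0|by rewrite lee_fin].
  over.
rewrite ge0_integralZr//=;
  [exact: (mf' ord0)|by move=> x _; rewrite lee_fin|].
by apply: integral_ge0 => t _; rewrite lee_fin prodr_ge0.
Qed.

Import HBNNSimple.

(** The hypothesis is the case of indicators; linearity extends it to simple functions and monotone
    convergence to all nonnegative measurable [f]. *)
Lemma ge0_integral_density d (T : measurableType d) (R : realType)
    (mu nu : {measure set T -> \bar R}) (p : T -> R) (f : T -> \bar R) :
  measurable_fun setT p -> (forall x, (0 <= p x)%R) ->
  (forall A, measurable A -> nu A = \int[mu]_(x in A) (p x)%:E) ->
  measurable_fun setT f -> (forall x, 0 <= f x) ->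
  \int[nu]_x f x = \int[mu]_x (f x * (p x)%:E).
Proof.
move=> mp p0 nuE mf f0.
have mpE : measurable_fun setT (EFin \o p) by exact/measurable_EFinP.
pose f_ := nnsfun_approx measurableT mf.
have f_ge0 n x : 0 <= (f_ n x)%:E by rewrite lee_fin.
have nd_f x m n : (m <= n)%N -> (f_ m x)%:E <= (f_ n x)%:E.
  by move=> mn; rewrite lee_fin; exact/lefP/nd_nnsfun_approx.
have cf x : (f_ n x)%:E @[n --> \oo] --> f x by exact: cvg_nnsfun_approx.
have step n : \int[nu]_x (f_ n x)%:E = \int[mu]_x ((f_ n x)%:E * (p x)%:E).
  under [LHS]eq_integral do rewrite fimfunE -fsumEFin//.
  rewrite [LHS]ge0_integral_fsum//; last 2 first.
    by move=> r; exact/measurable_EFinP/measurableT_comp.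
    by move=> r x _; rewrite EFinM nnfun_muleindic_ge0.
  under [RHS]eq_integral.
    move=> x xD; rewrite fimfunE -fsumEFin// muleC ge0_mule_fsumr; last first.
      by move=> r; rewrite EFinM nnfun_muleindic_ge0.
    over.
  rewrite [RHS]ge0_integral_fsum//; last 2 first.
    move=> r; apply: emeasurable_funM => //.
    by apply/measurable_EFinP/measurable_funM => //.
    by move=> r x _; rewrite mule_ge0//; [rewrite lee_fin|rewrite EFinM nnfun_muleindic_ge0].
  apply: eq_fsbigr => r _; rewrite integralZl_indic_nnsfun//= integral_indic//=.
  rewrite setIT nuE// integral_mkcond/=.
  (* For [r < 0] the level set of the nonnegative [f_ n] is empty and both sides vanish; only
     [r >= 0] can be moved inside the integral as a nonnegative factor. *)
  have [r0|r0] := leP 0%R r; last first.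
    rewrite (_ : f_ n @^-1` [set r] = set0); last first.
      by apply/seteqP; split=> x //= fx; move: r0; rewrite -fx ltNge fun_ge0.
    rewrite patch_set0 integral0 mule0.
    by rewrite integral0_eq// => x _; rewrite indicE in_set0 mulr0 mule0.
  rewrite -ge0_integralZl//=.
  - apply: eq_integral => x _; rewrite /patch indicE.
    by case: ifP => _ /=; rewrite ?mulr1 ?mulr0 ?mule0// muleC.
  - by apply/(measurable_restrictT _ _).1 => //; exact: measurable_funTS.
  - by move=> x _; rewrite erestrict_ge0// => y _; rewrite lee_fin.
transitivity (lim (\int[nu]_x (f_ n x)%:E @[n --> \oo])).
  rewrite -monotone_convergence//=.
  - by apply: eq_integral => x _; apply/esym/cvg_lim.
  - by move=> n; exact/measurable_EFinP/measurable_funTS.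
  - by move=> x _ m n; exact: nd_f.
rewrite (_ : (fun n => _) = fun n => \int[mu]_x ((f_ n x)%:E * (p x)%:E)); last first.
  exact/funext.
rewrite -monotone_convergence//=.
- apply: eq_integral => x _; apply/cvg_lim => //.
  by apply: cvgeMr => //; exact: cf.
- move=> n; apply: emeasurable_funM => //.
  exact/measurable_EFinP/measurable_funTS.
- by move=> n x _; rewrite mule_ge0// lee_fin.
- by move=> x _ m n mn; apply: lee_wpmul2r; rewrite ?lee_fin//; exact: nd_f.
Qed.

End measure_facts.

(** * Measurability of real functions and of parametrised integrals *)

Section real_measurability.
Context (R : realType).

(** Inversion is continuous off 0 and, by the convention [0^-1 = 0], constant on [{0}]. *)
Lemma measurable_invr : measurable_fun [set: R] (@GRing.inv R).
Proof.
have m0 : measurable [set x : R | x != 0].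
  by apply: open_measurable; exact: open_neq.
rewrite -(setUv [set x : R | x != 0]); apply/measurable_funU => //.
  exact: measurableC.
split.
  apply: open_continuous_measurable_fun; first exact: open_neq.
  by move=> x; rewrite inE => /= /inv_continuous.
apply: (@eq_measurable_fun _ _ _ _ _ (cst (0 : R))) => //.
by move=> x; rewrite inE/= => /negP; rewrite negbK => /eqP ->; rewrite invr0.
Qed.

Lemma measurable_sqrtr : measurable_fun [set: R] (@Num.sqrt R).
Proof. by apply: continuous_measurable_fun; exact: sqrt_continuous. Qed.

Lemma measurable_Rintegral_section d (T : measurableType d)
    (nu : probability (measurableTypeR R) R) (f : T -> R -> R) :
  measurable_fun [set: T * measurableTypeR R] (fun z => f z.1 z.2) ->
  (forall x y, 0 <= f x y) ->
  measurable_fun [set: T] (fun x => \int[nu]_y f x y).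
Proof.
move=> mf f0.
have := @measurable_fun_fubini_tonelli_F _ _ T (measurableTypeR R) R nu
  (EFin \o (fun z => f z.1 z.2)).
rewrite /fubini_F/= => mF.
apply: (measurableT_comp (fine_measurable measurableT)).
by apply: mF => [|z]; [exact/measurable_EFinP|rewrite lee_fin].
Qed.

End real_measurability.

(** * The unnormalised Gaussian kernel and its integrals under a normal law *)

Section gaussian_kernel.
Context (R : realType).
Local Notation RR := (measurableTypeR R).

(** The normal density of mean [m] and variance [s] without [(2 pi)^(-1/2)], a factor that the
    likelihood omits too. For [s <= 0] it is 0, so that its bounds and its joint measurability carry
    no sign condition on [s]. *)
Definition gauss_kernel (s x m : R) : R :=
  (Num.sqrt s)^-1 * expR (- (x - m) ^+ 2 / (2 * s)).

Lemma gauss_kernel_ge0 s x m : 0 <= gauss_kernel s x m.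
Proof. by rewrite mulr_ge0 ?invr_ge0 ?sqrtr_ge0 ?expR_ge0. Qed.

Lemma gauss_kernel_le s x m : gauss_kernel s x m <= (Num.sqrt s)^-1.
Proof.
have [s0|s0] := leP s 0.
  by rewrite /gauss_kernel (ler0_sqrtr s0) invr0 mul0r.
rewrite ler_piMr ?invr_ge0 ?sqrtr_ge0// -expR0 ler_expR mulNr oppr_le0.
by rewrite mulr_ge0 ?sqr_ge0// invr_ge0 mulr_ge0 ?ltW.
Qed.

Lemma measurable_gauss_kernel :
  measurable_fun [set: (RR * RR) * RR]
    (fun z => gauss_kernel z.1.2 z.1.1 z.2 : R).
Proof.
have m1 : measurable_fun [set: (RR * RR) * RR] (fun z => z.1.1 : R).
  exact: (measurableT_comp measurable_fst measurable_fst).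
have m2 : measurable_fun [set: (RR * RR) * RR] (fun z => z.1.2 : R).
  exact: (measurableT_comp measurable_snd measurable_fst).
have m3 : measurable_fun [set: (RR * RR) * RR] (fun z => z.2 : R).
  exact: measurable_snd.
apply: measurable_funM.
  apply: (measurableT_comp (@measurable_invr R)).
  exact: (measurableT_comp (@measurable_sqrtr R)).
apply: (measurableT_comp (@measurable_expR R)).
apply: measurable_funM.
  by apply: measurable_funN; apply: measurable_funX; exact: measurable_funB.
apply: (measurableT_comp (@measurable_invr R)).
by apply: measurable_funM => //; exact: measurable_cst.
Qed.

Lemma gauss_kernelE (s x m : R) : 0 < s ->
  gauss_kernel s x m = (normal_peak 1)^-1 * normal_pdf m (Num.sqrt s) x.
Proof.
move=> s0; have s'0 : Num.sqrt s != 0 by rewrite gt_eqF// sqrtr_gt0.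
rewrite normal_pdfE// mulrA; congr (_ * expR _).
  rewrite /normal_peak invrK expr1n mul1r sqr_sqrtr ?ltW//.
  have p0 : 0 <= (pi : R) *+ 2 by rewrite mulrn_wge0 ?pi_ge0.
  rewrite -mulrnAr sqrtrM ?ltW// invfM mulrCA mulfV ?mulr1// gt_eqF//.
  by rewrite sqrtr_gt0 mulrn_wgt0 ?pi_gt0.
by rewrite sqr_sqrtr ?ltW// mulr_natl.
Qed.

Lemma ge0_integral_normal_prob (m v : R) (f : R -> \bar R) :
  measurable_fun [set: RR] f -> (forall x, 0 <= f x)%E ->
  (\int[normal_prob m v]_x f x =
   \int[lebesgue_measure]_x (f x * (normal_pdf m v x)%:E))%E.
Proof.
move=> mf f0; apply: ge0_integral_density => //.
- exact: measurable_normal_pdf.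
- exact: normal_pdf_ge0.
Qed.

(** The exponential weight halves the Gaussian exponent, turning the density of variance [v] into
    [sqrt 2] times the density of variance [2 v]. *)
Lemma expR_sqr_normal_prob (m v : R) : 0 < v ->
  (\int[normal_prob m (Num.sqrt v)]_x (expR ((x - m) ^+ 2 / (4 * v)))%:E =
   (Num.sqrt 2)%:E)%E.
Proof.
move=> v0; rewrite ge0_integral_normal_prob//=; last first.
  apply/measurable_EFinP; apply: (measurableT_comp (@measurable_expR R)).
  apply: measurable_funM => //; apply: measurable_funX.
  by apply: measurable_funB => //.
have v0' : 0 < Num.sqrt v by rewrite sqrtr_gt0.
have vv0 : 0 < 2 * v by rewrite mulr_gt0.
have vv0' : 0 < Num.sqrt (2 * v) by rewrite sqrtr_gt0.
transitivity (\int[lebesgue_measure]_x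
    ((Num.sqrt 2)%:E * (normal_pdf m (Num.sqrt (2 * v)) x)%:E))%E.
  apply: eq_integral => x _; rewrite -!EFinM; congr EFin.
  apply: (mulfI (_ : (normal_peak 1)^-1 != 0)).
    by rewrite invr_neq0// gt_eqF// normal_peak_gt0// oner_neq0.
  rewrite mulrCA -(gauss_kernelE x m v0) [RHS]mulrCA -(gauss_kernelE x m vv0) /gauss_kernel.
  rewrite mulrCA -expRD sqrtrM// (invfM (Num.sqrt 2)) [RHS]mulrA [X in _ = X * _]mulrA divff ?mul1r; last first.
    by rewrite gt_eqF// sqrtr_gt0.
  by congr (_ * expR _); field; rewrite gt_eqF.
rewrite ge0_integralZl//=; first by rewrite integral_normal_pdf mule1.
- by apply/measurable_EFinP; exact: measurable_normal_pdf.
- by move=> x _; rewrite lee_fin normal_pdf_ge0.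
Qed.

(** The point is that the bound is uniform in [s] and [mu]; this is what makes the expected evidence
    finite. *)
Lemma normal_prob_gauss_kernel_le (m v s mu : R) : 0 < v -> 0 < s ->
  (\int[normal_prob m (Num.sqrt v)]_x (gauss_kernel s x mu)%:E <=
   ((Num.sqrt v)^-1)%:E)%E.
Proof.
move=> v0 s0.
have mg : measurable_fun [set: RR] (gauss_kernel s ^~ mu).
  have -> : gauss_kernel s ^~ mu =
      (fun x => (normal_peak 1)^-1 * normal_pdf mu (Num.sqrt s) x).
    by apply/funext => x; exact: gauss_kernelE.
  by apply: measurable_funM => //; exact: measurable_normal_pdf.
have v0' : 0 < Num.sqrt v by rewrite sqrtr_gt0.
rewrite ge0_integral_normal_prob//=; last 2 first.
  exact/measurable_EFinP.
  by move=> x; rewrite lee_fin gauss_kernel_ge0.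
apply: (@le_trans _ _ (\int[lebesgue_measure]_x
    (((Num.sqrt v)^-1)%:E * (normal_pdf mu (Num.sqrt s) x)%:E))%E); last first.
  rewrite ge0_integralZl//=.
  - by rewrite integral_normal_pdf mule1.
  - by apply/measurable_EFinP; exact: measurable_normal_pdf.
  - by move=> x _; rewrite lee_fin normal_pdf_ge0.
apply: ge0_le_integral => //=.
- by move=> x _; rewrite lee_fin mulr_ge0 ?gauss_kernel_ge0 ?normal_pdf_ge0.
- apply/measurable_EFinP; apply: measurable_funM => //.
  exact: measurable_normal_pdf.
- apply/measurable_EFinP; apply: measurable_funM => //.
  exact: measurable_normal_pdf.
(* The two Gaussians exchange roles: the factor [(2 pi)^(-1/2)] moves from the law of the data to
   the kernel. The kernel becomes a probability density in [x], and the law of the data becomes a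
   kernel of variance [v], at most [v^(-1/2)]. *)
move=> x _; rewrite -!EFinM lee_fin gauss_kernelE// mulrAC.
rewrite ler_wpM2r ?normal_pdf_ge0//.
by rewrite -gauss_kernelE// gauss_kernel_le.
Qed.

End gaussian_kernel.

(** * One coordinate: the Gaussian kernel averaged over a prior on the mean *)

Section gaussian_mixture.
Context (R : realType).
Local Notation RR := (measurableTypeR R).
Implicit Type nu : probability RR R.

Lemma integral_probability_le d (T : measurableType d) (P : probability T R)
    (f : T -> \bar R) (c : R) :
  measurable_fun setT f -> (forall x, 0 <= f x)%E -> (forall x, f x <= c%:E)%E ->
  (\int[P]_x f x <= c%:E)%E.
Proof.
move=> mf f0 fc; apply: (@le_trans _ _ (\int[P]_x c%:E)%E).
  by apply: ge0_le_integral => //; exact: measurable_cst.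
by rewrite integral_cst//= probability_setT mule1.
Qed.

Lemma measurable_gauss_kernel1 s x :
  measurable_fun [set: RR] (gauss_kernel s x : R -> R).
Proof. exact: (measurable_fun_pair2 (x, s) (@measurable_gauss_kernel R)). Qed.

(** Up to [(2 pi)^(-1/2)], the marginal density at [x] of one observation whose mean is drawn from
    [nu]. *)
Definition gauss_mix nu (s x : R) : R := \int[nu]_m gauss_kernel s x m.

Lemma gauss_mixE nu s x :
  (\int[nu]_m (gauss_kernel s x m)%:E)%E = (gauss_mix nu s x)%:E.
Proof.
rewrite /gauss_mix /Rintegral fineK// ge0_fin_numE; last first.
  by apply: integral_ge0 => m _; rewrite lee_fin gauss_kernel_ge0.
apply: (@le_lt_trans _ _ ((Num.sqrt s)^-1)%:E); last by rewrite ltry.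
apply: integral_probability_le.
- by apply/measurable_EFinP; exact: measurable_gauss_kernel1.
- by move=> m; rewrite lee_fin gauss_kernel_ge0.
- by move=> m; rewrite lee_fin gauss_kernel_le.
Qed.

Lemma gauss_mix_ge0 nu s x : 0 <= gauss_mix nu s x.
Proof. by apply: Rintegral_ge0 => m _; exact: gauss_kernel_ge0. Qed.

Lemma gauss_mix_le nu s x : gauss_mix nu s x <= (Num.sqrt s)^-1.
Proof.
rewrite -lee_fin -gauss_mixE; apply: integral_probability_le.
- by apply/measurable_EFinP; exact: measurable_gauss_kernel1.
- by move=> m; rewrite lee_fin gauss_kernel_ge0.
- by move=> m; rewrite lee_fin gauss_kernel_le.
Qed.

Lemma measurable_gauss_mix nu :
  measurable_fun [set: RR * RR] (fun z => gauss_mix nu z.2 z.1 : R).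
Proof.
apply: (@measurable_Rintegral_section R _ _ nu (fun z m => gauss_kernel z.2 z.1 m)).
  exact: measurable_gauss_kernel.
by move=> z m; exact: gauss_kernel_ge0.
Qed.

Lemma measurable_gauss_mix1 nu s :
  measurable_fun [set: RR] (gauss_mix nu s : R -> R).
Proof.
exact: (measurable_fun_pair1 (f := fun z : RR * RR => gauss_mix nu z.2 z.1 : R)
  s (measurable_gauss_mix nu)).
Qed.

Lemma gauss_mix_dirac s x : gauss_mix \d_(0 : RR) s x = gauss_kernel s x 0.
Proof.
apply: EFin_inj; rewrite -gauss_mixE integral_dirac//=.
  by rewrite diracT mul1e.
by apply/measurable_EFinP; exact: measurable_gauss_kernel1.
Qed.

Lemma normal_prob_gauss_mix_le nu m v s : 0 < v -> 0 < s ->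
  (\int[normal_prob m (Num.sqrt v)]_x (gauss_mix nu s x)%:E <=
   ((Num.sqrt v)^-1)%:E)%E.
Proof.
move=> v0 s0; under eq_integral do rewrite -gauss_mixE.
have mk : measurable_fun [set: RR * RR] (fun z => gauss_kernel s z.1 z.2 : R).
  have mh : measurable_fun [set: RR * RR] (fun z => ((z.1, s : RR), z.2)).
    apply: measurable_fun_pair => //.
    by apply: measurable_fun_pair => //; exact: measurable_fst.
  exact: (measurableT_comp (@measurable_gauss_kernel R) mh).
have k0 (z : RR * RR) : (0 <= (gauss_kernel s z.1 z.2)%:E)%E.
  by rewrite lee_fin gauss_kernel_ge0.
rewrite (@fubini_tonelli _ _ RR RR R (normal_prob m (Num.sqrt v)) nu
  (EFin \o (fun z => gauss_kernel s z.1 z.2)))//; last exact/measurable_EFinP.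
apply: integral_probability_le => [|y|y].
- apply: (@measurable_fun_fubini_tonelli_G _ _ RR RR R
    (normal_prob m (Num.sqrt v)) (EFin \o (fun z => gauss_kernel s z.1 z.2))).
    exact/measurable_EFinP.
  exact: k0.
- by apply: integral_ge0 => x _; exact: (k0 (x, y)).
- exact: normal_prob_gauss_kernel_le.
Qed.

Lemma measurable_norm_le (K : R) : measurable [set x : RR | `|x| <= K].
Proof.
rewrite (_ : [set _ | _] = `[- K, K]%classic); first exact: measurable_itv.
by apply/seteqP; split=> x /=; rewrite in_itv/= ler_norml.
Qed.

(** Only the means in [[-K, K]] are kept: they carry at least half of [nu], and there
    [(x - m)^2 <= 2 (x^2 + K^2)]. *)
Lemma gauss_mix_lb nu (K s x : R) : 0 < s -> 0 <= K ->
  ((2^-1)%:E <= nu [set m : RR | (`|m| <= K)%R])%E ->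
  (Num.sqrt s)^-1 * (2^-1 * expR (- (x ^+ 2 + K ^+ 2) / s)) <= gauss_mix nu s x.
Proof.
move=> s0 K0 nuK; rewrite -lee_fin -gauss_mixE.
have c0 : 0 <= (Num.sqrt s)^-1 * expR (- (x ^+ 2 + K ^+ 2) / s).
  by rewrite mulr_ge0 ?invr_ge0 ?sqrtr_ge0 ?expR_ge0.
apply: (@le_trans _ _ (\int[nu]_(m in [set m : RR | (`|m| <= K)%R])
    ((Num.sqrt s)^-1 * expR (- (x ^+ 2 + K ^+ 2) / s))%:E)%E).
  rewrite integral_cst/=; last exact: measurable_norm_le.
  by rewrite mulrCA mulrC EFinM lee_wpmul2l// lee_fin.
apply: (@le_trans _ _ (\int[nu]_(m in [set m : RR | (`|m| <= K)%R])
    (gauss_kernel s x m)%:E)%E); last first.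
  apply: ge0_subset_integral => //; first exact: measurable_norm_le.
    by apply/measurable_EFinP; exact: measurable_gauss_kernel1.
  by move=> m _; rewrite lee_fin gauss_kernel_ge0.
apply: ge0_le_integral => //=; first exact: measurable_norm_le.
  by apply/measurable_EFinP/measurable_funTS; exact: measurable_gauss_kernel1.
move=> m mK; rewrite lee_fin ler_wpM2l ?invr_ge0 ?sqrtr_ge0// ler_expR.
rewrite !mulNr lerN2 ler_pdivrMr ?mulr_gt0//.
have -> : (x ^+ 2 + K ^+ 2) / s * (2 * s) = 2 * (x ^+ 2 + K ^+ 2).
  by field; rewrite gt_eqF.
have : m ^+ 2 <= K ^+ 2 by rewrite -(real_normK (num_real m)) lerXn2r ?nnegrE.
by have := sqr_ge0 (x + m); rewrite sqrrB sqrrD; lra.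
Qed.

(** A prior mean [y] in [[-K, K]] is at distance at least [m / 2] from [m], so [x] is far from [y]
    or far from [m]. The first makes the kernel small; the second is charged to
    [exp ((x - m)^2 / v)], a noise term when [m] is the true mean. Outside [[-K, K]] the kernel is
    bounded by [s^(-1/2)] and the mass of [nu] is small. The two parts give the factor 2. *)
Lemma gauss_mix_ub nu (K m v s x a : R) : 0 < v -> v / 2 <= s -> s <= 3 / 2 * v ->
  0 <= K -> 2 * K <= m -> m ^+ 2 = a * v ->
  (nu (~` [set y : RR | (`|y| <= K)%R]) <= (expR (- (a / 24)))%:E)%E ->
  gauss_mix nu s x <=
  (Num.sqrt s)^-1 * (2 * expR (- (a / 24)) * expR ((x - m) ^+ 2 / v)).
Proof.
move=> v0 vs sv K0 Km ma nuK; have s0 : 0 < s by lra.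
have e1 : 1 <= expR ((x - m) ^+ 2 / v).
  by rewrite -expR0 ler_expR divr_ge0 ?sqr_ge0// ltW.
set D := [set y : RR | `|y| <= K].
have mD : measurable D by exact: measurable_norm_le.
have mk := measurable_gauss_kernel1 s x.
have bulk y : D y ->
    gauss_kernel s x y <=
    (Num.sqrt s)^-1 * (expR (- (a / 24)) * expR ((x - m) ^+ 2 / v)).
  rewrite /D/= => yK.
  rewrite -expRD ler_wpM2l ?invr_ge0 ?sqrtr_ge0// ler_expR mulNr.
  have my : m / 2 <= m - y by have := ler_norm y; lra.
  have q1 : (m / 2) ^+ 2 <= (m - y) ^+ 2 by rewrite lerXn2r ?nnegrE//; lra.
  have q2 : (m - y) ^+ 2 <= 2 * (x - y) ^+ 2 + 2 * (x - m) ^+ 2.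
    by have := sqr_ge0 (x - y + (x - m)); rewrite !expr2; lra.
  (* The constant 24 is [8 * 3]: the 8 arises here from [(m / 2)^2 = a v / 4] and the doubling in
     [q2], and the 3 from [2 s <= 3 v]. *)
  have q3 : a / 8 * v <= (x - y) ^+ 2 + (x - m) ^+ 2.
    by move: q1; rewrite expr_div_n ma; lra.
  set U := (x - y) ^+ 2 in q2 q3 *; set V := (x - m) ^+ 2 in q2 q3 *.
  have U0 : 0 <= U by exact: sqr_ge0.
  have V0 : 0 <= V by exact: sqr_ge0.
  have a0 : 0 <= a.
    by rewrite -(pmulr_lge0 _ v0) -ma sqr_ge0.
  have r1 : U / (3 * v) <= U / (2 * s).
    by rewrite ler_wpM2l// lef_pV2 ?posrE ?mulr_gt0//; lra.
  have r2 : a / 24 <= U / (3 * v) + V / (3 * v).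
    rewrite -mulrDl ler_pdivlMr ?mulr_gt0//; lra.
  have r3 : V / (3 * v) <= V / v.
    by rewrite ler_wpM2l// lef_pV2 ?posrE ?mulr_gt0//; lra.
  lra.
rewrite -lee_fin -gauss_mixE -(setUv D) ge0_integral_setU//=; last 4 first.
- exact: measurableC.
- by rewrite setUv; exact/measurable_EFinP.
- by move=> y _; rewrite lee_fin gauss_kernel_ge0.
- by rewrite disj_set2E setICr.
rewrite (_ : _ * _ = (Num.sqrt s)^-1 * (expR (- (a / 24)) * expR ((x - m) ^+ 2 / v))
  + (Num.sqrt s)^-1 * (expR (- (a / 24)) * expR ((x - m) ^+ 2 / v))); last by ring.
rewrite EFinD; apply: leeD.
  apply: (@le_trans _ _ (\int[nu]_(y in D) ((Num.sqrt s)^-1 *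
      (expR (- (a / 24)) * expR ((x - m) ^+ 2 / v)))%:E)%E).
    apply: ge0_le_integral => //=.
    - by move=> y _; rewrite lee_fin gauss_kernel_ge0.
    - by apply/measurable_EFinP; exact: measurable_funTS.
  rewrite (integral_cst nu mD) -[leRHS]mule1.
  apply: lee_wpmul2l; last exact: probability_le1.
  by rewrite lee_fin mulr_ge0 ?invr_ge0 ?sqrtr_ge0// mulr_ge0 ?expR_ge0.
apply: (@le_trans _ _ (\int[nu]_(y in ~` D) ((Num.sqrt s)^-1)%:E)%E).
  apply: ge0_le_integral => //=; first exact: measurableC.
  - by move=> y _; rewrite lee_fin gauss_kernel_ge0.
  - by apply/measurable_EFinP; exact: measurable_funTS.
  - by move=> y Dy; rewrite lee_fin gauss_kernel_le.
rewrite integral_cst//=; last exact: measurableC.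
rewrite EFinM; apply: lee_wpmul2l; first by rewrite lee_fin invr_ge0 sqrtr_ge0.
by apply: (le_trans nuK); rewrite lee_fin ler_peMr// expR_ge0.
Qed.

End gaussian_mixture.

(** * The likelihood as a product over coordinates, its expectation, and the noise event *)

Section likelihood_bounds.
Context (R : realType).
Local Notation RR := (measurableTypeR R).
Implicit Types (nu : probability RR R) (k n : nat).

Lemma expR1_ge2 : 2 <= expR 1 :> R.
Proof. by have := expR_ge1Dx (1 : R); rewrite -natr1. Qed.

(* The known zero means are encoded as means with prior [\d_0]. *)
Definition coord_prior k nu (i : nat) : probability RR R :=
  if (i < k)%N then (\d_(0 : RR) : probability RR R) else nu.

Definition mix_likelihood k nu n (X : n.-tuple R) (s : R) : R :=
  \prod_(i < n) gauss_mix (coord_prior k nu i) s (tnth X i).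

Lemma mix_likelihood_ge0 k nu n (X : n.-tuple R) s : 0 <= mix_likelihood k nu X s.
Proof. by apply: prodr_ge0 => i _; exact: gauss_mix_ge0. Qed.

Lemma measurable_mix_likelihood k nu n :
  measurable_fun [set: n.-tuple RR * RR]
    (fun z => mix_likelihood k nu z.1 z.2 : R).
Proof.
apply: measurable_prod => i _.
have mh : measurable_fun [set: n.-tuple RR * RR]
    (fun z => (tnth z.1 i : RR, z.2)).
  apply: measurable_fun_pair => //.
  exact: (measurableT_comp (measurable_tnth i) measurable_fst).
exact: (measurableT_comp (measurable_gauss_mix (coord_prior k nu i)) mh).
Qed.

Lemma measurable_mix_likelihood1 k nu n s :
  measurable_fun [set: n.-tuple RR] (fun X => mix_likelihood k nu X s : R).
Proof.
apply: measurable_prod => i _; apply: (measurableT_comp (measurable_gauss_mix1 _ _)).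
exact: measurable_tnth.
Qed.

Lemma gauss_mix_expR nu s x : 0 < s ->
  (\int[nu]_m (expR (- (x - m) ^+ 2 / (2 * s)))%:E =
   (Num.sqrt s * gauss_mix nu s x)%:E)%E.
Proof.
move=> s0; rewrite EFinM -gauss_mixE -ge0_integralZl//=.
- apply: eq_integral => m _; rewrite /gauss_kernel -EFinM mulrA divff ?mul1r//.
  by rewrite gt_eqF// sqrtr_gt0.
- by apply/measurable_EFinP; exact: measurable_gauss_kernel1.
- by move=> m _; rewrite lee_fin gauss_kernel_ge0.
Qed.

(** The integral over the unknown means factorises, and the power of [sqrt s] is shared out with one
    factor per coordinate. Known and unknown coordinates are then treated alike. *)
Lemma likelihoodE (alpha : R) nu n (X : n.-tuple R) s :
  (nzero alpha n <= n)%N -> 0 < s ->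
  likelihood alpha nu X s = mix_likelihood (nzero alpha n) nu X s.
Proof.
move=> kn s0; rewrite /likelihood /obsY /obsZ; move: (nzero alpha n) kn => k kn.
have s'0 : Num.sqrt s != 0 by rewrite gt_eqF// sqrtr_gt0.
pose e x m : R := expR (- (x - m) ^+ 2 / (2 * s)).
have me x : measurable_fun [set: RR] (e x : R -> R).
  apply: (measurableT_comp (@measurable_expR R)).
  apply: measurable_funM => //; apply: measurable_funN; apply: measurable_funX.
  by apply: measurable_funB => //; exact: measurable_cst.
pose Z := [tuple of drop k X].
have -> : \int[product_prob (fun=> nu)]_mu expR (- sqdist Z mu / (2 * s)) =
    \prod_(j < n - k) (Num.sqrt s * gauss_mix nu s (nth 0 X (k + j))).
  transitivity (fine (\int[product_prob (fun _ : 'I_(n - k) => nu)]_mu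
      (\prod_(j < n - k) e (tnth Z j) (tnth mu j))%:E)%E).
    congr fine; apply: eq_integral => mu _.
    by rewrite /sqdist -sumrN mulr_suml expR_sum.
  have /= -> := @ge0_integral_product_prob _ RR R _ (fun _ : 'I_(n - k) => nu)
    (fun j => e (tnth Z j)) (fun j => me _) (fun j m => expR_ge0 _).
  under eq_bigr do rewrite gauss_mix_expR//.
  rewrite prodEFin/=; apply: eq_bigr => j _.
  by rewrite (tnth_nth 0)/= nth_drop.
have -> : expR (- (\sum_(y <- take k X) y ^+ 2) / (2 * s)) =
    \prod_(0 <= i < k) e (nth 0 X i) 0.
  rewrite -sumrN mulr_suml expR_sum (big_nth 0) size_take size_tuple.
  have -> : (if (k < n)%N then k else n) = k by case: ltngtP kn.
  rewrite !big_nat; apply: eq_bigr => i /andP[_ ik].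
  by rewrite nth_take// /e subr0.
rewrite /mix_likelihood.
under [RHS]eq_bigr do rewrite (tnth_nth 0).
rewrite -(big_mkord xpredT (fun i => gauss_mix (coord_prior k nu i) s (nth 0 X i))).
rewrite (big_cat_nat (leq0n k) kn)/=.
have -> : \prod_(0 <= i < k) gauss_mix (coord_prior k nu i) s (nth 0 X i) =
    \prod_(0 <= i < k) ((Num.sqrt s)^-1 * e (nth 0 X i) 0).
  rewrite !big_nat; apply: eq_bigr => i /andP[_ ik].
  by rewrite /coord_prior ik gauss_mix_dirac.
have -> : \prod_(k <= i < n) gauss_mix (coord_prior k nu i) s (nth 0 X i) =
    \prod_(j < n - k) gauss_mix nu s (nth 0 X (k + j)).
  rewrite -{1}(add0n k) big_addn big_mkord; apply: eq_bigr => j _.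
  by rewrite addnC /coord_prior ltnNge leq_addr.
rewrite !big_split/= !prodr_const_nat subn0 prodr_const card_ord.
rewrite -exprVn -[X in _ ^+ X * _ * _](subnKC kn) exprD.
set A := \prod_(_ <= _ < _) _; set B := \prod_(_ < _) _.
(* Writing 1 as [((sqrt s)^-1 * sqrt s)^(n - k)] matches the factors [sqrt s] that [gauss_mix_expR]
   produced on the unknown coordinates. *)
rewrite -[RHS]mulr1 -(expr1n _ (n - k)) -(mulVf s'0) exprMn.
ring.
Qed.

Lemma likelihood_expectation_le k nu n (mean : 'I_n -> R) v s : 0 < v -> 0 < s ->
  (\int[product_prob (fun i => normal_prob (mean i) (Num.sqrt v) : probability RR R)]_X
     (mix_likelihood k nu X s)%:E <= ((Num.sqrt v)^-1 ^+ n)%:E)%E.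
Proof.
move=> v0 s0.
rewrite /mix_likelihood; have /= -> := @ge0_integral_product_prob _ RR R _
  (fun i => normal_prob (mean i) (Num.sqrt v)) _
  (fun i => measurable_gauss_mix1 (coord_prior k nu i) s)
  (fun i x => gauss_mix_ge0 _ _ _).
pose F (i : 'I_n) := (\int[normal_prob (mean i) (Num.sqrt v)]_x
    (gauss_mix (coord_prior k nu i) s x)%:E)%E.
  have F0 i : (0 <= F i)%E.
    by apply: integral_ge0 => x _; rewrite lee_fin gauss_mix_ge0.
  have Fle i : (F i <= ((Num.sqrt v)^-1)%:E)%E by exact: normal_prob_gauss_mix_le.
  have Ff i : F i = (fine (F i))%:E.
    by rewrite fineK// ge0_fin_numE// (le_lt_trans (Fle i))// ltry.
  rewrite (eq_bigr (fun i => (fine (F i))%:E)); last by move=> i _; exact: Ff.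
  rewrite prodEFin lee_fin -[X in _ ^+ X]card_ord -prodr_const ler_prod// => i _.
  by rewrite fine_ge0// -lee_fin -Ff Fle.
Qed.

Lemma measurable_dev n (mean : 'I_n -> R) :
  measurable_fun [set: n.-tuple RR]
    (fun X => \sum_(i < n) (tnth X i - mean i) ^+ 2 : R).
Proof.
apply: measurable_sum => i; apply: measurable_funX; apply: measurable_funB => //.
exact: measurable_tnth.
Qed.

Lemma measurable_dev_gt n (mean : 'I_n -> R) c :
  measurable [set X : n.-tuple RR | c < \sum_(i < n) (tnth X i - mean i) ^+ 2].
Proof.
rewrite (_ : [set _ | _] =
  (fun X : n.-tuple RR => \sum_(i < n) (tnth X i - mean i) ^+ 2 : R)
    @^-1` `]c, +oo[); last first.
  by apply/seteqP; split=> X /=; rewrite in_itv/= andbT.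
by rewrite -[X in measurable X]setTI; apply: measurable_dev.
Qed.

(* Chernoff bound: [E exp ((X_i - mean i)^2 / (4 v)) = sqrt 2 <= e]. *)
Lemma dev_prob_le n (mean : 'I_n -> R) (v : R) : 0 < v ->
  (product_prob (fun i => normal_prob (mean i) (Num.sqrt v) : probability RR R)
     [set X : n.-tuple RR | 8 * n%:R * v < \sum_(i < n) (tnth X i - mean i) ^+ 2]%R
   <= (expR (- n%:R))%:E)%E.
Proof.
move=> v0; set P := product_prob _; set D := [set _ | _].
have mD : measurable D by exact: measurable_dev_gt.
pose E (X : n.-tuple RR) : R :=
  \prod_(i < n) expR ((tnth X i - mean i) ^+ 2 / (4 * v)).
have mE : measurable_fun setT E.
  apply: measurable_prod => i _; apply: (measurableT_comp (@measurable_expR R)).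
  apply: measurable_funM => //; apply: measurable_funX; apply: measurable_funB => //.
  exact: measurable_tnth.
have mEE : measurable_fun [set: n.-tuple RR] (EFin \o E) by exact/measurable_EFinP.
have E0 X : 0 <= E X by apply: prodr_ge0 => i _; exact: expR_ge0.
have PE : (\int[P]_X (E X)%:E <= (expR n%:R)%:E)%E.
  have mf (i : 'I_n) : measurable_fun [set: RR]
      (fun x : R => expR ((x - mean i) ^+ 2 / (4 * v))).
    apply: (measurableT_comp (@measurable_expR R)).
    by apply: measurable_funM => //; apply: measurable_funX; exact: measurable_funB.
  have /= -> := @ge0_integral_product_prob _ RR R _
    (fun i => normal_prob (mean i) (Num.sqrt v)) _ mf (fun i x => expR_ge0 _).
  under eq_bigr do rewrite expR_sqr_normal_prob//.
  rewrite prodEFin lee_fin prodr_const card_ord -[n%:R]mulr1 expRM_natl.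
  rewrite lerXn2r ?nnegrE ?sqrtr_ge0 ?expR_ge0//.
  apply: (@le_trans _ _ 2); last exact: expR1_ge2.
  have {2}-> : (2 : R) = Num.sqrt (2 ^+ 2) by rewrite sqrtr_sqr ger0_norm.
  by rewrite ler_sqrt// expr2 ler_peMr// ler1n.
(* Markov's inequality: on [D] the exponent of [E] exceeds [8 n v / (4 v) = 2 n], while the
   expectation of [E] is at most [e^n]. *)
have : ((expR (2 * n%:R))%:E * P D <= (expR n%:R)%:E)%E.
  rewrite -(integral_cst P mD); apply: le_trans PE.
  apply: (@le_trans _ _ (\int[P]_(X in D) (E X)%:E)%E); last first.
    by apply: ge0_subset_integral => // X _; rewrite lee_fin E0.
  apply: ge0_le_integral => //.
  - by move=> X _; rewrite lee_fin expR_ge0.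
  - exact: measurable_funTS.
  move=> X; rewrite /D/= => DX; rewrite lee_fin /E -expR_sum ler_expR -mulr_suml.
  by rewrite ler_pdivlMr ?mulr_gt0//; lra.
move=> PD; have -> : expR (- n%:R) = (expR (2 * n%:R))^-1 * expR n%:R :> R.
  by rewrite -expRN -expRD; congr expR; ring.
by rewrite EFinM lee_pdivlMl ?expR_gt0.
Qed.

End likelihood_bounds.

(** * Comparison of the likelihood at the true and at the inflated variance *)

Definition block_mean (R : realType) (k : nat) (m : R) (i : nat) : R :=
  if (i < k)%N then 0 else m.

Definition sqdev (R : realType) (k : nat) (m : R) n (X : n.-tuple R) : R :=
  \sum_(i < n) (tnth X i - block_mean k m i) ^+ 2.

Lemma sumr_tail (R : realType) (k n : nat) (c : R) : (k <= n)%N ->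
  \sum_(i < n) (if (i < k)%N then 0 else c) = (n - k)%:R * c.
Proof.
move=> kn.
rewrite -(big_mkord xpredT (fun i => if (i < k)%N then 0 else c)).
rewrite (big_cat_nat (leq0n k) kn)/= big_nat big1 ?add0r; last first.
  by move=> i /andP[_ ->].
rewrite big_nat (eq_bigr (fun=> c)); last first.
  by move=> i /andP[ki _]; rewrite ltnNge ki.
by rewrite -big_nat sumr_const_nat mulr_natl.
Qed.

Lemma coord_prior_ball (R : realType) (k i : nat)
    (nu : probability (measurableTypeR R) R) (K : R) : 0 <= K ->
  ((2^-1)%:E <= nu [set y : measurableTypeR R | (`|y| <= K)%R])%E ->
  ((2^-1)%:E <= coord_prior k nu i [set y : measurableTypeR R | (`|y| <= K)%R])%E.
Proof.
move=> K0 nuK; rewrite /coord_prior; case: ifP => // _.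
by rewrite /= diracE mem_set/= ?normr0// lee_fin; lra.
Qed.

Lemma mix_likelihood_ub (R : realType) (nu : probability (measurableTypeR R) R)
    (k n : nat) (K m v a : R) (X : n.-tuple R) (s : R) :
  (k <= n)%N -> 0 < v -> 0 <= K -> 2 * K <= m -> m ^+ 2 = a * v ->
  v / 2 <= s -> s <= 3 / 2 * v ->
  (nu (~` [set y : measurableTypeR R | (`|y| <= K)%R]) <= (expR (- (a / 24)))%:E)%E ->
  sqdev k m X <= 8 * n%:R * v ->
  mix_likelihood k nu X s <=
  (Num.sqrt (v / 2))^-1 ^+ n * expR (9 * n%:R - (n - k)%:R * (a / 24)).
Proof.
move=> kn v0 K0 Km ma vs sv nuK devX; have s0 : 0 < s by lra.
have sv2 : (Num.sqrt s)^-1 <= (Num.sqrt (v / 2))^-1.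
  by rewrite lef_pV2 ?posrE ?sqrtr_gt0 ?divr_gt0// ler_sqrt// ltW.
(* The summand 1 absorbs the factor [2 <= e] of [gauss_mix_ub]. Known zero coordinates only use the
   bound [s^(-1/2)]. With the noise sum, at most [8 n] after division by [v], this makes [9 n]. *)
pose w (i : 'I_n) := 1 - (if (i < k)%N then 0 else a / 24)
  + (tnth X i - block_mean k m i) ^+ 2 / v.
apply: (@le_trans _ _ (\prod_(i < n) ((Num.sqrt (v / 2))^-1 * expR (w i)))).
  apply: ler_prod => i _; rewrite gauss_mix_ge0/= /w /block_mean /coord_prior.
  case: ifPn => ik.
    apply: (le_trans (gauss_mix_le _ _ _)); apply: (le_trans sv2).
    rewrite ler_peMr ?invr_ge0 ?sqrtr_ge0// -expR0 ler_expR subr0.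
    by rewrite addr_ge0// divr_ge0 ?sqr_ge0// ltW.
  apply: (le_trans (gauss_mix_ub (tnth X i) v0 vs sv K0 Km ma nuK)).
  apply: ler_pM => //; rewrite ?invr_ge0 ?sqrtr_ge0//.
  rewrite !expRD ler_wpM2r ?expR_ge0// ler_wpM2r ?expR_ge0//.
  exact: expR1_ge2.
rewrite big_split/= prodr_const card_ord -expR_sum.
rewrite ler_wpM2l ?exprn_ge0 ?invr_ge0 ?sqrtr_ge0// ler_expR.
rewrite big_split/= sumrB sumr_tail// sumr_const card_ord -mulr_suml.
have : sqdev k m X / v <= 8 * n%:R by rewrite ler_pdivrMr.
rewrite /sqdev; lra.
Qed.

Lemma mix_likelihood_lb (R : realType) (nu : probability (measurableTypeR R) R)
    (k n : nat) (K m v a : R) (X : n.-tuple R) (t : R) :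
  0 < v -> 0 <= K -> m ^+ 2 = a * v ->
  1000 <= a -> K ^+ 2 <= v -> a * v <= t -> t <= 2 * a * v ->
  ((2^-1)%:E <= nu [set y : measurableTypeR R | (`|y| <= K)%R])%E ->
  sqdev k m X <= 8 * n%:R * v ->
  (Num.sqrt (2 * a * v))^-1 ^+ n * expR (- (4 * n%:R)) <= mix_likelihood k nu X t.
Proof.
move=> v0 K0 ma a1 Kv avt tav nuK devX; have a0 : 0 < a by lra.
have av0 : 0 < a * v by rewrite mulr_gt0.
have t0 : 0 < t by exact: lt_le_trans avt.
have tav2 : (Num.sqrt (2 * a * v))^-1 <= (Num.sqrt t)^-1.
  have tav0 : 0 < 2 * a * v by exact: lt_le_trans tav.
  by rewrite lef_pV2 ?posrE ?sqrtr_gt0// ler_sqrt// ltW.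
(* In [31 / 10], 1 pays for [ln 2], 2 for the squared mean, at most [a v], and [1 / 10] for
   [K^2 <= v <= a v / 10]. The noise sum costs at most [16 n / a <= 9 n / 10], which completes
   [4 n]. *)
pose w (i : 'I_n) := - (31 / 10) - 2 / (a * v) * (tnth X i - block_mean k m i) ^+ 2.
apply: (@le_trans _ _ (\prod_(i < n) ((Num.sqrt (2 * a * v))^-1 * expR (w i)))).
  rewrite big_split/= prodr_const card_ord -expR_sum.
  rewrite ler_wpM2l ?exprn_ge0 ?invr_ge0 ?sqrtr_ge0// ler_expR.
  rewrite sumrB sumr_const card_ord -mulr_sumr -/(sqdev k m X).
  have : 2 / (a * v) * sqdev k m X <= 2 / (a * v) * (8 * n%:R * v).
    by rewrite ler_wpM2l// divr_ge0// ltW.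
  have -> : 2 / (a * v) * (8 * n%:R * v) = 16 / a * n%:R.
    by field; rewrite !gt_eqF.
  have : 16 / a * n%:R <= 9 / 10 * n%:R.
    by rewrite ler_wpM2r// ler_pdivrMr//; lra.
  rewrite -mulr_natr; lra.
apply: ler_prod => i _.
rewrite mulr_ge0 ?invr_ge0 ?sqrtr_ge0 ?expR_ge0//=.
apply: (le_trans _ (gauss_mix_lb (tnth X i) t0 K0 (coord_prior_ball k i K0 nuK))).
apply: ler_pM => //; rewrite ?invr_ge0 ?sqrtr_ge0 ?expR_ge0//.
have -> : 2^-1 = expR (- ln 2) :> R by rewrite expRN lnK// posrE.
rewrite -expRD ler_expR /w.
have ln2 : ln 2 <= 1 :> R.
  by rewrite -[leRHS](expRK (1 : R)) ler_ln ?posrE ?expR_gt0// expR1_ge2.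
set x := tnth X i.
have mean2 : block_mean k m i ^+ 2 <= a * v.
  by rewrite /block_mean; case: ifP => _; rewrite ?ma// expr0n/= ltW.
have x2 : x ^+ 2 <= 2 * (x - block_mean k m i) ^+ 2 + 2 * (a * v).
  by have := sqr_ge0 (x - block_mean k m i - block_mean k m i); rewrite !expr2 in mean2 *; lra.
have va : v <= 1 / 10 * (a * v) by rewrite mulrA ler_peMl ?ltW//; lra.
have : (x ^+ 2 + K ^+ 2) / t <= (2 * (x - block_mean k m i) ^+ 2 + 21 / 10 * (a * v)) / (a * v).
  apply: ler_pM; rewrite ?invr_ge0 ?addr_ge0 ?sqr_ge0// ?(ltW t0)//; last first.
    by rewrite lef_pV2 ?posrE.
  lra.
have -> : (2 * (x - block_mean k m i) ^+ 2 + 21 / 10 * (a * v)) / (a * v) =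
    2 / (a * v) * (x - block_mean k m i) ^+ 2 + 21 / 10.
  by field; rewrite !gt_eqF.
rewrite mulNr; lra.
Qed.

Lemma mix_likelihood_ratio (R : realType) (nu : probability (measurableTypeR R) R)
    (k n : nat) (K C v b : R) (X : n.-tuple R) (s t : R) :
  (k <= n)%N -> 0 < b -> b <= 1 -> b * n%:R <= (n - k)%:R -> C = 1000 / b ->
  0 < v -> 0 <= K -> K ^+ 2 <= v ->
  (nu (~` [set y : measurableTypeR R | (`|y| <= K)%R]) <=
    (expR (- (C ^+ 2 / 24)))%:E)%E ->
  ((2^-1)%:E <= nu [set y : measurableTypeR R | (`|y| <= K)%R])%E ->
  sqdev k (C * Num.sqrt v) X <= 8 * n%:R * v ->
  v / 2 <= s -> s <= 3 / 2 * v -> C ^+ 2 * v <= t -> t <= 2 * C ^+ 2 * v ->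
  mix_likelihood k nu X s <= expR (- n%:R) * mix_likelihood k nu X t.
Proof.
move=> kn b0 b1 bn CE v0 K0 Kv nuK nuK2 devX vs sv Ct tC.
have bC : b * C = 1000 by rewrite CE mulrCA divff ?mulr1// gt_eqF.
have C1 : 1000 <= C by rewrite CE ler_pdivlMr//; lra.
have sv0 : 0 < Num.sqrt v by rewrite sqrtr_gt0.
have ma : (C * Num.sqrt v) ^+ 2 = C ^+ 2 * v by rewrite exprMn sqr_sqrtr// ltW.
have Ksv : K <= Num.sqrt v.
  by rewrite -(ger0_norm K0) -sqrtr_sqr ler_sqrt// ltW.
have Km : 2 * K <= C * Num.sqrt v.
  by apply: ler_pM => //; lra.
have CC : 1000 <= C ^+ 2.
  by rewrite expr2; apply: (le_trans C1); rewrite ler_peMl//; lra.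
apply: (le_trans (mix_likelihood_ub kn v0 K0 Km ma vs sv nuK devX)).
apply: le_trans; last first.
  apply: ler_wpM2l; first exact: expR_ge0.
  exact: (mix_likelihood_lb v0 K0 ma CC Kv Ct tC nuK2 devX).
rewrite [leRHS]mulrCA -expRD.
(* The normalising factors of the two bounds differ by [2 C] per coordinate. *)
have -> : Num.sqrt (2 * C ^+ 2 * v) = 2 * C * Num.sqrt (v / 2).
  rewrite (_ : 2 * C ^+ 2 * v = (2 * C) ^+ 2 * (v / 2)); last by field.
  by rewrite sqrtrM ?sqr_ge0// sqrtr_sqr ger0_norm//; lra.
rewrite invfM exprMn -[leRHS]mulrA [leRHS]mulrCA ler_wpM2l ?exprn_ge0 ?invr_ge0 ?sqrtr_ge0//.
rewrite exprVn ler_pdivlMl ?exprn_gt0//; last by lra.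
(* The crude bound [(2 C)^n <= exp (2 C n)] leaves a comparison of exponents:
   [(2 C + 14) n <= (n - k) C^2 / 24]. The right side is at least [1000 C n / 24], which suffices
   because [C >= 1000]. *)
apply: (@le_trans _ _ (expR (2 * C * n%:R + (9 * n%:R - (n - k)%:R * (C ^+ 2 / 24))))).
  rewrite [leRHS]expRD ler_wpM2r ?expR_ge0// [2 * C * n%:R]mulrC expRM_natl lerXn2r ?nnegrE ?expR_ge0//.
    by lra.
  by have := expR_ge1Dx (2 * C); lra.
rewrite ler_expR.
have h1 : (b * n%:R) * (C ^+ 2 / 24) <= (n - k)%:R * (C ^+ 2 / 24).
  by rewrite ler_wpM2r// divr_ge0 ?sqr_ge0.
have h2 : (b * n%:R) * (C ^+ 2 / 24) = 1000 / 24 * (C * n%:R).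
  by rewrite -bC; field.
have h3 : 1000 * n%:R <= C * n%:R by rewrite ler_wpM2r.
have h4 : 0 <= n%:R :> R by [].
lra.
Qed.

Lemma ge0_integral_gt0 d (T : measurableType d) (R : realType)
    (mu : {measure set T -> \bar R}) (D : set T) (f : T -> R) :
  measurable D -> measurable_fun D f -> (forall x, D x -> 0 < f x) ->
  mu D != 0%E -> (0 < \int[mu]_(x in D) (f x)%:E)%E.
Proof.
move=> mD mf f0 muD; rewrite lt0e integral_ge0 ?andbT; last first.
  by move=> x Dx; rewrite lee_fin ltW// f0.
apply: contra muD => /eqP If0.
have mfE : measurable_fun D (EFin \o f) by exact/measurable_EFinP.
have [N [mN muN DN]] : ae_eq mu D (EFin \o f) (cst 0%E).
  apply/(ae_eq_integral_abs mu mD mfE); rewrite -[RHS]If0.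
  by apply: eq_integral => x; rewrite inE => Dx /=; rewrite ger0_norm// ltW// f0.
rewrite -measure_le0 -muN le_measure ?inE// => x Dx; apply: DN => /= fx.
by have := f0 _ Dx; have [->] := fx Dx; rewrite ltxx.
Qed.

(** * The unnormalised posterior: measurability, normalisation and expectation *)

Section posterior_mass.
Context (R : realType).
Local Notation RR := (measurableTypeR R).
Local Notation leb := (@lebesgue_measure R).
Let pos : set R := `]0, +oo[.

Let posE s : pos s = (0 < s) :> Prop.
Proof. by rewrite /pos/= in_itv/= andbT. Qed.

Lemma C1_density_measurable (prior : R -> R) : C1_positive_density prior ->
  measurable_fun (pos : set RR) (prior : RR -> R).
Proof.
case=> _ dprior _ _; apply: subspace_continuous_measurable_fun.
  exact: measurable_itv.
apply: derivable_within_continuous => s; rewrite in_itv/= andbT.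
exact: dprior.
Qed.

Context (alpha : R) (nu : probability RR R) (prior : R -> R) (n : nat).
Hypothesis prior_density : C1_positive_density prior.
Hypothesis zero_le : (nzero alpha n <= n)%N.
Local Notation k := (nzero alpha n).

(** Extended-valued, so that infinite evidence stays visible, whereas [evidence] sends it to 0. *)
Definition posterior_mass (X : n.-tuple R) (D : set R) : \bar R :=
  (\int[leb]_(s in D) (likelihood alpha nu X s * prior s)%:E)%E.

Let prior_gt0 s : pos s -> 0 < prior s.
Proof. by case: prior_density => h _ _ _; rewrite posE => /h. Qed.

Let mpos : measurable (pos : set RR). Proof. exact: measurable_itv. Qed.

(** A version of the integrand that is measurable on the whole product space, as Tonelli's theorem
    requires. It uses [mix_likelihood], which agrees with [likelihood] for [s > 0], and cuts the
    prior off outside [D]. *)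
Let density (D : set R) (z : n.-tuple RR * RR) : R :=
  mix_likelihood k nu z.1 z.2 * (prior \_ D) z.2.

Let density_ge0 (D : set R) z : D `<=` pos -> 0 <= density D z.
Proof.
move=> Dpos; rewrite mulr_ge0 ?mix_likelihood_ge0// patchE.
by case: ifPn => // /set_mem/Dpos/prior_gt0/ltW.
Qed.

Let measurable_density (D : set R) : measurable (D : set RR) -> D `<=` pos ->
  measurable_fun [set: n.-tuple RR * RR] (density D).
Proof.
move=> mD Dpos; apply: measurable_funM; first exact: measurable_mix_likelihood.
have mprior : measurable_fun [set: RR] (prior \_ D : RR -> R).
  apply: (measurable_restrictT (prior : RR -> R) mD).1.
  exact: (measurable_funS mpos Dpos (C1_density_measurable prior_density)).
exact: (measurableT_comp mprior measurable_snd).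
Qed.

Let posterior_massE (X : n.-tuple R) (D : set R) : D `<=` pos ->
  posterior_mass X D = (\int[leb]_s (density D (X, s))%:E)%E.
Proof.
move=> Dpos; rewrite /posterior_mass integral_mkcond; apply: eq_integral => s _.
rewrite /density/= !patchE; case: ifPn => sD; last by rewrite mulr0.
by rewrite likelihoodE//; move/set_mem/Dpos: sD; rewrite posE.
Qed.

Lemma posterior_mass_ge0 (X : n.-tuple R) (D : set R) : D `<=` pos ->
  (0 <= posterior_mass X D)%E.
Proof.
move=> Dpos; rewrite posterior_massE//; apply: integral_ge0 => s _.
by rewrite lee_fin density_ge0.
Qed.

Lemma measurable_posterior_mass (D : set R) : measurable (D : set RR) ->
  D `<=` pos -> measurable_fun [set: n.-tuple RR] (posterior_mass ^~ D).
Proof.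
move=> mD Dpos.
have -> : posterior_mass ^~ D = fun X => (\int[leb]_s (density D (X, s))%:E)%E.
  by apply/funext => X; exact: posterior_massE.
apply: (@measurable_fun_fubini_tonelli_F _ _ (n.-tuple RR) RR R leb
  (EFin \o density D)).
  by apply/measurable_EFinP; exact: measurable_density.
by move=> z; rewrite lee_fin density_ge0.
Qed.

Lemma measurable_likelihood_prior (X : n.-tuple R) (D : set R) : measurable (D : set RR) ->
  D `<=` pos -> measurable_fun (D : set RR)
    (fun s : RR => likelihood alpha nu X s * prior s : R).
Proof.
move=> mD Dpos.
have := measurable_fun_pair2 (X : n.-tuple RR) (measurable_density mD Dpos).
move=> /(@measurable_funTS _ _ _ _ D); apply: eq_measurable_fun => s.
rewrite inE => sD; rewrite /density/= patchE mem_set//.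
by rewrite likelihoodE// -posE; exact: Dpos.
Qed.

Lemma le_posterior_mass (X : n.-tuple R) (D E : set R) :
  measurable (D : set RR) -> measurable (E : set RR) -> D `<=` E -> E `<=` pos ->
  (posterior_mass X D <= posterior_mass X E)%E.
Proof.
move=> mD mE DE Epos; apply: ge0_subset_integral => //.
  by apply/measurable_EFinP; exact: measurable_likelihood_prior.
move=> s Es; have sp := Epos _ Es; rewrite lee_fin mulr_ge0//.
  by rewrite likelihoodE ?mix_likelihood_ge0// -posE.
by rewrite ltW ?prior_gt0.
Qed.

Lemma posterior_mass_setC (X : n.-tuple R) (A : set R) : measurable (A : set RR) ->
  (posterior_mass X (pos `&` A) + posterior_mass X (pos `&` ~` A) =
   posterior_mass X pos)%E.
Proof.
move=> mA; rewrite /posterior_mass -ge0_integral_setU//=.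
- by rewrite -setIUr setUv setIT.
- exact: measurableI.
- by apply: measurableI => //; exact: measurableC.
- rewrite -setIUr setUv setIT.
  by apply/measurable_EFinP; exact: measurable_likelihood_prior.
- move=> s sA; have sp : pos s by case: sA => -[].
  rewrite lee_fin mulr_ge0//.
    by rewrite likelihoodE ?mix_likelihood_ge0// -posE.
  by rewrite ltW ?prior_gt0.
- by rewrite disj_set2E setIACA setICr setI0.
Qed.

Lemma posteriorE (X : n.-tuple R) (A : set R) : measurable (A : set RR) ->
  posterior alpha nu prior X A =
  fine (posterior_mass X (pos `&` A)) / fine (posterior_mass X pos).
Proof.
move=> mA; rewrite /posterior /posterior_density /Rintegral.
have mpA : measurable (pos `&` A : set RR) by exact: measurableI.
have pApos : pos `&` A `<=` pos by exact: subIsetl.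
have -> : evidence alpha nu prior X = fine (posterior_mass X pos) by [].
set c := fine (posterior_mass X pos).
have c0 : 0 <= c by rewrite fine_ge0// posterior_mass_ge0.
under eq_integral do rewrite EFinM.
rewrite ge0_integralZr//=; last 3 first.
- by apply/measurable_EFinP; exact: measurable_likelihood_prior.
- move=> s [sp _]; rewrite lee_fin mulr_ge0//.
    by rewrite likelihoodE ?mix_likelihood_ge0// -posE.
  by rewrite ltW ?prior_gt0.
- by rewrite lee_fin invr_ge0.
rewrite -/(posterior_mass X (pos `&` A)).
have := le_posterior_mass X mpA mpos pApos (@subset_refl _ _).
have := posterior_mass_ge0 X pApos; rewrite /c.
(* If the mass of [A] is infinite then so is the total mass, whose [fine] is 0; both sides are then
   0 since [0^-1 = 0]. *)
case: (posterior_mass X (pos `&` A)) => [r||]//= _.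
by rewrite leye_eq => /eqP -> /=; rewrite invr0 mule0 mul0r.
Qed.

Lemma measurable_posterior (A : set R) : measurable (A : set RR) ->
  measurable_fun [set: n.-tuple RR] (fun X => posterior alpha nu prior X A : R).
Proof.
move=> mA.
have -> : (fun X : n.-tuple R => posterior alpha nu prior X A) = fun X =>
    fine (posterior_mass X (pos `&` A)) / fine (posterior_mass X pos).
  by apply/funext => X; exact: posteriorE.
have mfine (D : set R) : measurable (D : set RR) -> D `<=` pos ->
    measurable_fun [set: n.-tuple RR] (fun X => fine (posterior_mass X D)).
  move=> mD Dpos; apply: (measurableT_comp (fine_measurable measurableT)).
  exact: measurable_posterior_mass.
apply: measurable_funM; first by apply: mfine => //; exact: measurableI.
by apply: (measurableT_comp (@measurable_invr R)); exact: mfine.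
Qed.

Lemma posterior_ge0 (X : n.-tuple R) (A : set R) : measurable (A : set RR) ->
  0 <= posterior alpha nu prior X A.
Proof.
by move=> mA; rewrite posteriorE// divr_ge0// fine_ge0// posterior_mass_ge0.
Qed.

Lemma posterior_le1 (X : n.-tuple R) (A : set R) : measurable (A : set RR) ->
  posterior alpha nu prior X A <= 1.
Proof.
move=> mA; rewrite posteriorE//.
have mpA : measurable (pos `&` A : set RR) by exact: measurableI.
have := le_posterior_mass X mpA mpos (@subIsetl _ _ _) (@subset_refl _ _).
have := posterior_mass_ge0 X (@subset_refl _ pos).
have := posterior_mass_ge0 X (@subIsetl _ pos A).
case: (posterior_mass X (pos `&` A)) => [r||]//=; last by rewrite mul0r ler01.
case: (posterior_mass X pos) => [r'||]//=; last by rewrite invr0 mulr0 ler01.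
rewrite !lee_fin => r0 r'0 rr'.
have [->|r'1] := eqVneq r' 0; first by rewrite invr0 mulr0 ler01.
by rewrite ler_pdivrMr ?mul1r// lt_neqAle eq_sym r'1.
Qed.

(** With zero or infinite evidence, both terms would be 0 by convention. *)
Lemma posterior_setC (X : n.-tuple R) (A : set R) : measurable (A : set RR) ->
  (0 < posterior_mass X pos)%E -> (posterior_mass X pos < +oo)%E ->
  posterior alpha nu prior X A + posterior alpha nu prior X (~` A) = 1.
Proof.
move=> mA m0 moo; rewrite !posteriorE//; last exact: measurableC.
rewrite -mulrDl -fineD.
- rewrite posterior_mass_setC// divff// gt_eqF// fine_gt0// m0 moo//.
- rewrite ge0_fin_numE; last by apply: posterior_mass_ge0; exact: subIsetl.
  apply: le_lt_trans moo; apply: le_posterior_mass => //; exact: measurableI.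
- rewrite ge0_fin_numE; last by apply: posterior_mass_ge0; exact: subIsetl.
  apply: le_lt_trans moo; apply: le_posterior_mass => //; apply: measurableI => //.
  exact: measurableC.
Qed.

Lemma posterior_mass_expectation (mean : 'I_n -> R) (v : R) : 0 < v ->
  (\int[product_prob (fun i => normal_prob (mean i) (Num.sqrt v) : probability RR R)]_X
     posterior_mass X pos <= ((Num.sqrt v)^-1 ^+ n)%:E)%E.
Proof.
move=> v0; set P := product_prob _.
under eq_integral do rewrite posterior_massE//.
have mdens := measurable_density mpos (@subset_refl _ _).
have dens0 z := density_ge0 z (@subset_refl _ pos).
have mdensE : measurable_fun [set: n.-tuple RR * RR] (EFin \o density pos).
  exact/measurable_EFinP.
rewrite (@fubini_tonelli _ _ (n.-tuple RR) RR R P leb (EFin \o density pos))//.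
have c0 : 0 <= (Num.sqrt v)^-1 ^+ n by rewrite exprn_ge0 ?invr_ge0 ?sqrtr_ge0.
have p0 (s : R) : 0 <= (prior \_ pos) s.
  by rewrite patchE; case: ifPn => // /set_mem/prior_gt0/ltW.
have mp : measurable_fun [set: RR] (prior \_ pos : RR -> R).
  apply: (measurable_restrictT (prior : RR -> R) mpos).1.
  exact: C1_density_measurable.
apply: (@le_trans _ _ (\int[leb]_s
    (((Num.sqrt v)^-1 ^+ n)%:E * ((prior \_ pos) s)%:E))%E).
  apply: ge0_le_integral => //=.
  - by move=> s _; apply: integral_ge0 => X _; rewrite lee_fin.
  - exact: (@measurable_fun_fubini_tonelli_G _ _ (n.-tuple RR) RR R P
      (EFin \o density pos)).
  - by apply/measurable_EFinP; exact: measurable_funM.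
  move=> s _; rewrite /density/=; under eq_integral do rewrite EFinM.
  (* The bound on the expected likelihood is available for [s > 0]; elsewhere the prior has been cut
     off to 0. *)
  have [s0|s0] := ltP 0 s; last first.
    have -> : (prior \_ pos) s = 0.
      rewrite patchE memNset// posE => /lt_le_trans/(_ s0).
      by rewrite ltxx.
    by under eq_integral do rewrite mule0; rewrite integral0 mule0.
  rewrite ge0_integralZr//=.
  - by apply: lee_wpmul2r; rewrite ?lee_fin//; exact: likelihood_expectation_le.
  - apply/measurable_EFinP.
    exact: measurable_mix_likelihood1.
  - by move=> X _; rewrite lee_fin mix_likelihood_ge0.
  - by rewrite lee_fin.
rewrite ge0_integralZl//=; last by move=> s _; rewrite lee_fin.
- case: prior_density => _ _ _ prior1.
  rewrite (_ : integral _ _ _ = 1%E) ?mule1//.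
  rewrite -[RHS]prior1 [RHS]integral_mkcond; apply: eq_integral => s _.
  by rewrite !patchE; case: ifP.
- exact/measurable_EFinP.
Qed.

End posterior_mass.

(** * From likelihood ratios to posterior probabilities *)

Section posterior_concentration.
Context (R : realType).
Local Notation RR := (measurableTypeR R).
Local Notation leb := (@lebesgue_measure R).
Implicit Types (nu : probability RR R) (prior : R -> R) (n : nat).
Let pos : set R := `]0, +oo[.

Lemma mix_likelihood_gt0 k nu n (K : R) (X : n.-tuple R) (s : R) :
  0 < s -> 0 <= K -> ((2^-1)%:E <= nu [set y : RR | (`|y| <= K)%R])%E ->
  0 < mix_likelihood k nu X s.
Proof.
move=> s0 K0 nuK; apply: prodr_gt0 => i _.
apply: lt_le_trans (gauss_mix_lb (tnth X i) s0 K0 (coord_prior_ball k i K0 nuK)).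
by rewrite !mulr_gt0 ?invr_gt0 ?sqrtr_gt0 ?expR_gt0.
Qed.

Lemma posterior_mass_gt0 (alpha : R) nu prior n (K : R) (X : n.-tuple R) :
  C1_positive_density prior -> (nzero alpha n <= n)%N ->
  0 <= K -> ((2^-1)%:E <= nu [set y : RR | (`|y| <= K)%R])%E ->
  (0 < posterior_mass alpha nu prior X pos)%E.
Proof.
move=> dprior kn K0 nuK; apply: ge0_integral_gt0.
- exact: measurable_itv.
- by apply: measurable_likelihood_prior => //; exact: measurable_itv.
- move=> s; rewrite /pos/= in_itv/= andbT => s0; rewrite mulr_gt0//.
    by rewrite likelihoodE// (mix_likelihood_gt0 _ _ s0 K0).
  by case: dprior => h _ _ _; exact: h.
- have h := lebesgue_measure_itv (`]0, +oo[ : interval R).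
  rewrite ltry in h. by rewrite [X in X != _]h.
Qed.

(** The ratio bound is multiplied by [prior s * prior t] and integrated over [s] in [A] and [t] in
    [E]. This bounds [b] times the mass of [A] by [c] times the mass of [E], because [A] has prior
    mass at most 1. *)
Lemma posterior_le_ratio (alpha : R) nu prior n (X : n.-tuple R) (A E : set R)
    (c b : R) :
  C1_positive_density prior -> (nzero alpha n <= n)%N ->
  measurable (A : set RR) -> measurable (E : set RR) -> E `<=` pos ->
  0 <= c -> 0 < b -> (\int[leb]_(s in E) (prior s)%:E = b%:E)%E ->
  (forall s t, pos s -> A s -> E t ->
     likelihood alpha nu X s <= c * likelihood alpha nu X t) ->
  posterior alpha nu prior X A <= c / b.
Proof.
move=> dprior kn mA mE Epos c0 b0 Eb ratio.
have mpos : measurable (pos : set RR) by exact: measurable_itv.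
have mpA : measurable (pos `&` A : set RR) by exact: measurableI.
have pApos : pos `&` A `<=` pos by exact: subIsetl.
have prior0 s : pos s -> 0 <= prior s.
  by case: dprior => h _ _ _; rewrite /pos/= in_itv/= andbT => /h/ltW.
have L0 s : pos s -> 0 <= likelihood alpha nu X s.
  rewrite /pos/= in_itv/= andbT => s0.
  by rewrite likelihoodE// mix_likelihood_ge0.
have LP0 s : pos s -> 0 <= likelihood alpha nu X s * prior s.
  by move=> sp; rewrite mulr_ge0 ?L0 ?prior0.
have mL (D : set R) : measurable (D : set RR) -> D `<=` pos ->
    measurable_fun (D : set RR)
      (EFin \o (fun s : RR => likelihood alpha nu X s * prior s : R)).
  by move=> mD Dpos; apply/measurable_EFinP; exact: measurable_likelihood_prior.
have mprior (D : set R) : measurable (D : set RR) -> D `<=` pos ->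
    measurable_fun (D : set RR) (EFin \o (prior : RR -> R)).
  move=> mD Dpos; apply/measurable_EFinP.
  exact: (measurable_funS mpos Dpos (C1_density_measurable dprior)).
set J := posterior_mass alpha nu prior X.
have priorA1 : (\int[leb]_(s in pos `&` A) (prior s)%:E <= 1)%E.
  case: (dprior) => _ _ _ <-; apply: ge0_subset_integral => //.
    exact: mprior.
(* The product form remains meaningful when the masses are infinite; the quotient is taken only
   after the cases of infinite and zero evidence, where the posterior is 0. *)
have main : (J (pos `&` A) * b%:E <= c%:E * J pos)%E.
  rewrite /J /posterior_mass -ge0_integralZr//=; last 3 first.
  - exact: mL.
  - by move=> s [sp _]; rewrite lee_fin LP0.
  - by rewrite lee_fin ltW.
  apply: (@le_trans _ _ (\int[leb]_(s in pos `&` A)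
      ((prior s)%:E * (c%:E * J E)))%E).
    apply: ge0_le_integral => //=.
    - by move=> s [sp _]; rewrite mule_ge0// lee_fin ?LP0// ltW.
    - by apply: emeasurable_funM => //; exact: mL.
    - by apply: emeasurable_funM => //; exact: mprior.
    move=> s [sp sA]; rewrite -Eb -ge0_integralZl//=; last 3 first.
    - exact: mprior.
    - by move=> t /Epos tp; rewrite lee_fin prior0.
    - by rewrite lee_fin LP0.
    rewrite muleA -ge0_integralZl//=; last 3 first.
    - exact: mL.
    - by move=> t /Epos tp; rewrite lee_fin LP0.
    - by rewrite mule_ge0 ?lee_fin ?prior0.
    apply: ge0_le_integral => //=.
    - by move=> t /Epos tp; rewrite mule_ge0 ?lee_fin ?LP0 ?prior0.
    - by apply: emeasurable_funM => //; exact: mprior.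
    - by apply: emeasurable_funM => //; exact: mL.
    move=> t tE; rewrite -!EFinM lee_fin.
    rewrite [X in _ <= X](_ : _ = (c * likelihood alpha nu X t) * (prior s * prior t)); last by ring.
    rewrite [X in X <= _](_ : _ = likelihood alpha nu X s * (prior s * prior t)); last by ring.
    by rewrite ler_wpM2r ?mulr_ge0 ?prior0//; [exact: Epos|exact: ratio].
  have JE0 : (0 <= J E)%E.
    apply: integral_ge0 => t /Epos tp.
    by rewrite lee_fin LP0.
  rewrite ge0_integralZr//=; last 3 first.
  - exact: mprior.
  - by move=> s [sp _]; rewrite lee_fin prior0.
  - by rewrite mule_ge0.
  apply: (@le_trans _ _ (1 * (c%:E * J E))%E).
    by apply: lee_wpmul2r; rewrite ?mule_ge0.
  rewrite mul1e; apply: lee_wpmul2l; first by rewrite lee_fin.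
  exact: le_posterior_mass.
rewrite posteriorE//.
have := posterior_mass_ge0 nu dprior kn X pApos.
have := posterior_mass_ge0 nu dprior kn X (@subset_refl _ pos).
have := le_posterior_mass nu dprior kn X mpA mpos pApos (@subset_refl _ pos).
move: main; rewrite -/(J _) -/(J _).
have cb0 : 0 <= c / b by rewrite divr_ge0// ltW.
case: (J pos) => [r||]//=; last by rewrite invr0 mulr0.
case: (J (pos `&` A)) => [r'||]//=.
rewrite -!EFinM !lee_fin => r'b _ r0 r'0.
have [->|rn0] := eqVneq r 0; first by rewrite invr0 mulr0.
have rgt0 : 0 < r by rewrite lt_neqAle eq_sym rn0.
by rewrite ler_pdivrMr// mulrAC ler_pdivlMr.
Qed.

(** The evidence is positive for all data and has finite expectation, hence is finite almost surely;
    so the two posterior probabilities add up to 1 almost surely. *)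
Lemma posterior_expectation_setC (alpha : R) nu prior n (K v : R)
    (mean : 'I_n -> R) (A : set R) :
  let P := product_prob
    (fun i => normal_prob (mean i) (Num.sqrt v) : probability RR R) in
  C1_positive_density prior -> (nzero alpha n <= n)%N -> 0 < v ->
  0 <= K -> ((2^-1)%:E <= nu [set y : RR | (`|y| <= K)%R])%E ->
  measurable (A : set RR) ->
  (\int[P]_X (posterior alpha nu prior X A)%:E +
   \int[P]_X (posterior alpha nu prior X (~` A))%:E = 1)%E.
Proof.
move=> P dprior kn v0 K0 nuK mA.
have mAC : measurable (~` A : set RR) by exact: measurableC.
have mp (B : set R) : measurable (B : set RR) -> measurable_fun [set: n.-tuple RR]
    (EFin \o (fun X => posterior alpha nu prior X B : R)).
  by move=> mB; apply/measurable_EFinP; exact: measurable_posterior.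
have p0 (B : set R) (X : n.-tuple RR) : measurable (B : set RR) ->
    (0 <= (posterior alpha nu prior X B)%:E)%E.
  by move=> mB; rewrite lee_fin posterior_ge0.
rewrite -ge0_integralD//=; last 4 first.
- by move=> X _; exact: p0.
- exact: mp.
- by move=> X _; exact: p0.
- exact: mp.
have mpos : measurable (pos : set RR) by exact: measurable_itv.
have mmass := measurable_posterior_mass nu dprior kn mpos (@subset_refl _ pos).
have mass0 X := posterior_mass_ge0 nu dprior kn X (@subset_refl _ pos).
have imass : P.-integrable [set: n.-tuple RR]
    (fun X => posterior_mass alpha nu prior X pos).
  apply/integrableP; split => //.
  under eq_integral do rewrite gee0_abs//.
  apply: le_lt_trans (posterior_mass_expectation nu dprior kn mean v0) _.
  by rewrite ltry.
transitivity (\int[P]_X (cst 1%E X))%E; last first.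
  by rewrite integral_cst//= probability_setT mule1.
apply: ae_eq_integral => //.
- by apply: emeasurable_funD; exact: mp.
apply: filterS (integrable_ae measurableT imass) => X fX _ /=.
rewrite -EFinD posterior_setC//; first exact: posterior_mass_gt0 K0 nuK.
by rewrite -ge0_fin_numE// fX.
Qed.

End posterior_concentration.

(** Continuity from below along the balls of integer radius, which exhaust the line. *)
Lemma probability_tight (R : realType) (nu : probability (measurableTypeR R) R)
    (e : R) : 0 < e -> exists2 K : R, 0 <= K &
  (nu (~` [set y : measurableTypeR R | (`|y| <= K)%R]) <= e%:E)%E.
Proof.
move=> e0; pose F (j : nat) := [set y : measurableTypeR R | (`|y| <= j%:R)%R].
have mF j : measurable (F j) by exact: measurable_norm_le.
have FT : \bigcup_j F j = setT.
  apply/seteqP; split=> // y _; exists (Num.truncn `|y|).+1 => //=.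
  by rewrite /F/= ltW// truncnS_gt.
have cF : (nu \o F) j @[j --> \oo] --> 1%E.
  rewrite -(@probability_setT _ _ _ nu) -FT; apply: nondecreasing_cvg_mu => //.
  - by rewrite FT.
  - by move=> i j ij; apply/subsetPset => y /le_trans; apply; rewrite ler_nat.
apply: contrapT => noK.
have : (1 <= (1 - e)%:E)%E; last by rewrite lee_fin; lra.
apply: cvge_le cF; apply: nearW => j /=; rewrite leNgt; apply/negP => ej.
apply: noK; exists j%:R => //; rewrite -/(F j) probability_setC//.
rewrite leeBlDr; last exact: fin_num_measure.
by rewrite -leeBlDl// -EFinB ltW.
Qed.

(** * The counterexample inside the model: counting coordinates and the exponential bound *)

Section model_facts.
Context (R : realType).
Local Notation RR := (measurableTypeR R).

Lemma nzero_le (alpha : R) n : 0 <= alpha -> alpha < 1 -> (nzero alpha n <= n)%N.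
Proof.
move=> a0 a1; rewrite /nzero truncn_le_nat (@le_lt_trans _ _ n%:R)// ?ltr_nat//.
by rewrite ler_piMr// ltW.
Qed.

Lemma nzeroB_ge (alpha : R) n : 0 <= alpha -> alpha < 1 ->
  (1 - alpha) * n%:R <= (n - nzero alpha n)%:R.
Proof.
move=> a0 a1; rewrite natrB ?nzero_le//.
have : (nzero alpha n)%:R <= n%:R * alpha by rewrite truncn_le mulr_ge0.
by lra.
Qed.

Lemma mean0_nseq (alpha m : R) n (i : 'I_n) : 0 <= alpha ->
  mean0 [tuple of nseq (n - nzero alpha n) m] i = block_mean (nzero alpha n) m i.
Proof.
move=> a0; rewrite /mean0 /block_mean/=.
(* With 0-based indices, [i < floor (n alpha)] means [i + 1 <= n alpha]: exactly the negation of the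
   test in [mean0]. *)
have -> : (i < nzero alpha n)%N = (i.+1%:R <= n%:R * alpha).
  by rewrite /nzero truncn_gt_nat.
rewrite ltNge; case: leP => //= h; rewrite nth_nseq ifT// ltn_sub2r//.
  by rewrite (leq_ltn_trans _ (ltn_ord i))// /nzero truncn_le_nat.
Qed.

Lemma posterior_expectation_le (alpha : R) (nu : probability RR R)
    (prior : R -> R) n (K C v b : R) (A : set R) :
  0 <= alpha -> alpha < 1 -> C1_positive_density prior ->
  C = 1000 / (1 - alpha) -> 0 < v -> 0 <= K -> K ^+ 2 <= v ->
  (nu (~` [set y : RR | (`|y| <= K)%R]) <= (expR (- (C ^+ 2 / 24)))%:E)%E ->
  ((2^-1)%:E <= nu [set y : RR | (`|y| <= K)%R])%E ->
  measurable (A : set RR) -> (forall s, A s -> v / 2 <= s <= 3 / 2 * v) ->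
  0 < b ->
  (\int[lebesgue_measure]_(s in `[(C ^+ 2 * v)%R, (2 * C ^+ 2 * v)%R]) (prior s)%:E =
    b%:E)%E ->
  (\int[P0 v [tuple of nseq (n - nzero alpha n) (C * Num.sqrt v)%R]]_X
     (posterior alpha nu prior X A)%:E <= (expR (- n%:R) * (b^-1 + 1))%:E)%E.
Proof.
move=> a0 a1 dprior CE v0 K0 Kv nuK nuK2 mA Av b0 bE.
have kn := nzero_le n a0 a1.
set mu := [tuple of _]; set P := P0 _ _.
pose D := [set X : n.-tuple RR |
  8 * n%:R * v < \sum_(i < n) (tnth X i - mean0 mu i) ^+ 2].
have mD : measurable D by exact: measurable_dev_gt.
have PD : (P D <= (expR (- n%:R))%:E)%E by exact: dev_prob_le.
have C0 : 0 < C by rewrite CE; apply: divr_gt0; lra.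
(* On the noise event [D] the posterior is bounded by 1; off [D] the likelihood ratio applies, with
   [c = e^-n] and an interval of prior mass [b]. *)
have bound (X : n.-tuple RR) :
    posterior alpha nu prior X A <= expR (- n%:R) / b + \1_D X.
  rewrite indicE; have [XD|XD] := boolP (X \in D).
    apply: (le_trans (posterior_le1 nu dprior kn X mA)).
    by rewrite lerDr divr_ge0 ?expR_ge0// ltW.
  rewrite addr0.
  apply: (posterior_le_ratio dprior kn mA (measurable_itv _) _ (expR_ge0 _) b0 bE).
    move=> t /=; rewrite !in_itv/= andbT => /andP[+ _]; apply: lt_le_trans.
    by rewrite mulr_gt0// exprn_gt0.
  move=> s t; rewrite /= in_itv/= andbT => s0 /Av/andP[vs sv].
  rewrite in_itv/= => /andP[Ct tC].
  have t0 : 0 < t by apply: lt_le_trans Ct; rewrite mulr_gt0// exprn_gt0.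
  rewrite !likelihoodE//.
  apply: (mix_likelihood_ratio kn (b := 1 - alpha) (C := C) (v := v) (K := K)) => //.
  - by rewrite subr_gt0.
  - by rewrite gerBl.
  - exact: nzeroB_ge.
  move/negP: XD; rewrite inE /D/= => /negP; rewrite -leNgt.
  by under eq_bigr do rewrite mean0_nseq//.
apply: (@le_trans _ _
    (\int[P]_X ((expR (- n%:R) / b)%:E + (\1_D X)%:E))%E).
  apply: ge0_le_integral => //=.
  - by move=> X _; rewrite lee_fin posterior_ge0.
  - by apply/measurable_EFinP; exact: measurable_posterior.
  - by apply/measurable_EFinP; apply: measurable_funD => //; exact: measurable_indic.
  - by move=> X _; rewrite -EFinD lee_fin bound.
rewrite ge0_integralD//=; [|
  by move=> X _; rewrite lee_fin divr_ge0 ?expR_ge0// ltW|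
  by apply/measurable_EFinP; exact: measurable_indic].
rewrite mulrDr mulr1 EFinD; apply: leeD; last by rewrite integral_indic// setIT.
apply: integral_probability_le => [|X|X] //.
by rewrite lee_fin divr_ge0 ?expR_ge0// ltW.
Qed.

End model_facts.

(** * From the limit of expectations to inconsistency *)

(** Since [f <= 1], it is at most [1 / 2] plus the indicator of [f > 1 / 2]. An expectation tending
    to 1 thus prevents the probability of that event from vanishing. *)
Lemma expectation_le_half (d : measure_display) (T : measurableType d)
    (R : realType) (P : probability T R) (f : T -> R) :
  measurable_fun [set: T] f -> (forall x, 0 <= f x <= 1) ->
  (\int[P]_x (f x)%:E <= (1 / 2)%:E + P [set x | 1 / 2 < f x]%R)%E.
Proof.
move=> mf f01; set D := [set x | _].
have mD : measurable D.
  rewrite (_ : D = f @^-1` `]1 / 2, +oo[); last first.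
    by apply/seteqP; split=> x /=; rewrite in_itv/= andbT.
  by rewrite -[X in measurable X]setTI; exact: mf.
apply: (@le_trans _ _ (\int[P]_x ((1 / 2)%:E + (\1_D x)%:E))%E).
  apply: ge0_le_integral => //=.
  - by move=> x _; rewrite lee_fin; case/andP: (f01 x).
  - exact/measurable_EFinP.
  - by apply/measurable_EFinP; apply: measurable_funD => //; exact: measurable_indic.
  move=> x _; rewrite -EFinD lee_fin indicE.
  have /andP[f0 f1] := f01 x; have [xD|xD] := boolP (x \in D); first by rewrite mulr1n; lra.
  rewrite mulr0n addr0 leNgt; apply/negP => h.
  by move/negP: xD; apply; rewrite inE.
rewrite ge0_integralD//=; [|
  by apply/measurable_EFinP; exact: measurable_indic].
apply: leeD; last by rewrite integral_indic// setIT.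
by apply: integral_probability_le.
Qed.

Theorem theorem4p2 (R : realType) (alpha : R)
    (nu : probability (measurableTypeR R) R) (prior : R -> R) :
  0 <= alpha -> alpha < 1 ->
  C1_positive_density prior ->
  exists M : R, forall v0 : R, 0 < v0 -> M < v0 ->
  exists mu0 : forall n : nat, (n - nzero alpha n).-tuple R,
    [/\ 'E_(P0 v0 (mu0 n))[fun X =>
            posterior alpha nu prior X [set s : R | `|s / v0 - 1| <= 1 / 2]%R]%E
          @[n --> \oo] --> 0%E,
        'E_(P0 v0 (mu0 n))[fun X =>
            posterior alpha nu prior X [set s : R | 1 / 2 < `|s / v0 - 1|]%R]%E
          @[n --> \oo] --> 1%E
      & ~ posterior_consistent nu prior v0 mu0].

Proof.
move=> a0 a1 dprior.
pose C := 1000 / (1 - alpha).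
have C0 : 0 < C by apply: divr_gt0; lra.
(* The first bound on the tail of [nu] feeds the upper bound on the likelihood near [v], the second
   the lower bound at the inflated variance. *)
have e0 : 0 < Num.min (expR (- (C ^+ 2 / 24))) (1 / 2) :> R.
  by rewrite lt_min expR_gt0; lra.
have [K K0 nuK] := probability_tight nu e0.
have nuK1 : (nu (~` [set y : measurableTypeR R | (`|y| <= K)%R]) <=
    (expR (- (C ^+ 2 / 24)))%:E)%E.
  by apply: (le_trans nuK); rewrite lee_fin ge_min lexx.
have nuK2 : ((2^-1)%:E <= nu [set y : measurableTypeR R | (`|y| <= K)%R])%E.
  have : (nu (~` [set y : measurableTypeR R | (`|y| <= K)%R]) <= (1 / 2)%:E)%E.
    by apply: (le_trans nuK); rewrite lee_fin ge_min lexx orbT.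
  rewrite probability_setC; last exact: measurable_norm_le.
  rewrite leeBlDr; last by apply: fin_num_measure; exact: measurable_norm_le.
  rewrite -leeBlDl// -EFinB; apply: le_trans.
  by rewrite lee_fin; lra.
(* [K] was chosen from [alpha] and [nu] alone. The condition [K^2 <= v] puts [C sqrt v] beyond
   [2 K], and makes [K^2] negligible against [C^2 v]. *)
exists (K ^+ 2) => v v0 /ltW Kv.
pose mu0 n := [tuple of nseq (n - nzero alpha n) (C * Num.sqrt v)].
exists mu0.
set A := [set s : R | `|s / v - 1| <= 1 / 2].
have AC : [set s : R | 1 / 2 < `|s / v - 1|] = ~` A.
  by apply/seteqP; split=> s; rewrite /A/= ltNge => /negP.
have AE : A = `[v / 2, 3 / 2 * v]%classic.
  apply/seteqP; split=> s; rewrite /A/= in_itv/= ler_norml => /andP[h1 h2].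
    have h3 : 1 / 2 * v <= s by rewrite -ler_pdivlMr//; lra.
    have h4 : s <= 3 / 2 * v by rewrite -ler_pdivrMr//; lra.
    by apply/andP; split; lra.
  have h3 : 1 / 2 <= s / v by rewrite ler_pdivlMr//; lra.
  have h4 : s / v <= 3 / 2 by rewrite ler_pdivrMr//; lra.
  by apply/andP; split; lra.
have mA : measurable (A : set (measurableTypeR R)).
  by rewrite AE; exact: measurable_itv.
have mAC : measurable (~` A : set (measurableTypeR R)) by exact: measurableC.
pose B : set R := `[C ^+ 2 * v, 2 * C ^+ 2 * v]%classic.
have Cv0 : 0 < C ^+ 2 * v by rewrite mulr_gt0// exprn_gt0.
have Bpos : B `<=` `]0, +oo[%classic.
  move=> s; rewrite /B/= !in_itv/= andbT => /andP[+ _].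
  exact: lt_le_trans.
have mB : measurable (B : set (measurableTypeR R)) by exact: measurable_itv.
have mprior := C1_density_measurable dprior.
(* Positivity of the prior density on an interval of positive length gives [b > 0]. It may depend on
   [v], but not on [n]. *)
have [b [b0 bE]] : exists b : R, 0 < b /\
    (\int[lebesgue_measure]_(s in B) (prior s)%:E = b%:E)%E.
  have prior_gt0 s : `]0, +oo[%classic s -> 0 < prior s.
    by case: (dprior) => h _ _ _; rewrite /= in_itv/= andbT; exact: h.
  have B0 : (0 < \int[lebesgue_measure]_(s in B) (prior s)%:E)%E.
    apply: ge0_integral_gt0 => //.
    - exact: (measurable_funS (measurable_itv _) Bpos mprior).
    - by move=> s /Bpos/prior_gt0.
    have h := lebesgue_measure_itv (`[C ^+ 2 * v, 2 * C ^+ 2 * v] : interval R).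
    rewrite [X in X != _]h/= lte_fin ifT; last by lra.
    by rewrite -EFinB eqe gt_eqF//; lra.
  have B1 : (\int[lebesgue_measure]_(s in B) (prior s)%:E <= 1)%E.
    case: (dprior) => _ _ _ <-; apply: ge0_subset_integral => //.
    - exact/measurable_EFinP.
    - by move=> s /prior_gt0/ltW; rewrite lee_fin.
  exists (fine (\int[lebesgue_measure]_(s in B) (prior s)%:E)%E); split.
    by rewrite fine_gt0// B0 (le_lt_trans B1)// ltry.
  by rewrite fineK// ge0_fin_numE ?(ltW B0)// (le_lt_trans B1)// ltry.
have kn n : (nzero alpha n <= n)%N by exact: nzero_le.
pose EX (D : set R) n :=
  (\int[P0 v (mu0 n)]_X (posterior alpha nu prior X D)%:E)%E.
have EA0 n : (0 <= EX A n)%E.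
  by apply: integral_ge0 => X _; rewrite lee_fin posterior_ge0.
have EA n : (EX A n <= (expR (- n%:R) * (b^-1 + 1))%:E)%E.
  apply: (@posterior_expectation_le R alpha nu prior n K C v b A a0 a1 dprior
    (erefl C) v0 K0 Kv nuK1 nuK2 mA _ b0 bE).
  by move=> s; rewrite AE/= in_itv.
have cA : EX A n @[n --> \oo] --> 0%E.
  apply: (@squeeze_cvge _ _ _ _ (cst 0%E) _
      (fun n => (expR (- n%:R) * (b^-1 + 1))%:E)).
  - by apply: nearW => n; rewrite EA0 EA.
  - exact: cvg_cst.
  - apply: cvg_EFin; first exact: nearW.
    rewrite -(mul0r (b^-1 + 1)); apply: cvgM; last exact: cvg_cst.
    exact: cvgn_expR.
have EAC n : EX (~` A) n = (1 - EX A n)%E.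
  have := posterior_expectation_setC (mean0 (mu0 n)) dprior (kn n) v0 K0 nuK2 mA.
  rewrite -/(P0 v (mu0 n)) -/(EX A n) -/(EX (~` A) n) => <-.
  rewrite addeAC addeC subee ?adde0//.
  by rewrite ge0_fin_numE// (le_lt_trans (EA n))// ltry.
have cAC : EX (~` A) n @[n --> \oo] --> 1%E.
  have -> : EX (~` A) = fun n => (1 - EX A n)%E by exact/funext.
  have h : (1 - EX A n)%E @[n --> \oo] --> (1 - 0)%E.
    by apply: (cvgeB _ (cvg_cst 1%E) cA).
  by rewrite sube0 in h.
split.
- by rewrite unlock.
- by rewrite unlock AC.
move=> consistent.
(* Consistency is tested with radius [v / 2], for which the outer region is the complement of [A],
   and with [delta = 1 / 2]. The expectation tending to 1 would then have a limit at most
   [1 / 2]. *)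
have cP : P0 v (mu0 n) [set X | 1 / 2 < posterior alpha nu prior X (~` A)]
    @[n --> \oo] --> 0%E.
  have -> : ~` A = [set s : R | v / 2 < `|s - v|].
    rewrite -AC; apply/seteqP; split=> s /=.
      rewrite (_ : s / v - 1 = (s - v) / v); last by field; rewrite gt_eqF.
      by rewrite normrM normfV (gtr0_norm v0) ltr_pdivlMr//; lra.
    rewrite (_ : s / v - 1 = (s - v) / v); last by field; rewrite gt_eqF.
    by rewrite normrM normfV (gtr0_norm v0) ltr_pdivlMr//; lra.
  by apply: consistent; lra.
have : (1 <= (1 / 2)%:E + 0 :> \bar R)%E; last by rewrite adde0 lee_fin; lra.
apply: (lee_cvg_to cAC (cvgeD _ (cvg_cst _) cP)) => //.
apply: nearW => n; apply: expectation_le_half.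
  exact: measurable_posterior.
by move=> X; rewrite posterior_ge0 ?posterior_le1.
Qed.
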